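(* Let $\mathcal A$ be a van Hove sequence in $G$, and let $f,g\in Bap^2_{\mathcal A}(G)$ with $g\in L^\infty(G)$. Then the twisted Eberlein convolution $[f,g]_{\mathcal A}$ exists, $[f,g]_{\mathcal A}\in SAP(G)$, and for all $\chi\in\widehat G$ $$a_\chi^{\mathcal A}([f,g]_{\mathcal A})=a_\chi^{\mathcal A}(f)\,\overline{a_\chi^{\mathcal A}(g)}.$$
   Context: $G$ is a second countable, locally compact (Hausdorff) Abelian group with Haar measure $|\cdot|$ and dual group $\widehat G$. A van Hove sequence is a sequence $\mathcal A=(A_n)_{n\in\mathbb N}$ of precompact open subsets of $G$ (of positive measure) such that $\lim_{n}|\partial^K A_n|/|A_n|=0$ for each compact $K\subseteq G$, where for open $A$, $\partial^K A:=(\overline{A+K}\setminus A)\cup(((G\setminus A)-K)\cap\overline A)$. For measurable $f,g:G\to\mathbb C$, the twisted Eberlein convolution $[f,g]_{\mathcal A}$ is the function on $G$ given by $[f,g]_{\mathcal A}(t)=\lim_{n\to\infty}\frac1{|A_n|}\int_{A_n}f(s)\overline{g(s-t)}\,ds$; it is said to exist if this limit exists for all $t\in G$. For $f\in L^2_{\mathrm{loc}}(G)$, $\|f\|_{b,2,\mathcal A}=(\limsup_{n}\frac1{|A_n|}\int_{A_n}|f(t)|^2\,dt)^{1/2}$, and $BL^2_{\mathcal A}(G)=\{f\in L^2_{\mathrm{loc}}(G):\|f\|_{b,2,\mathcal A}<\infty\}$. $Bap^2_{\mathcal A}(G)$ (Besicovitch 2-almost periodic functions) is the closure in $BL^2_{\mathcal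 A}(G)$ of the set of trigonometric polynomials (finite linear combinations of characters) with respect to $\|\cdot\|_{b,2,\mathcal A}$. $SAP(G)$ is the set of bounded uniformly continuous functions $f$ such that the closure of the set of translates $\{f(\cdot-t):t\in G\}$ in the supremum norm is compact. The Fourier–Bohr coefficient of $f\in L^1_{\mathrm{loc}}(G)$ at $\chi\in\widehat G$ is $a_\chi^{\mathcal A}(f)=\lim_{n\to\infty}\frac1{|A_n|}\int_{A_n}f(s)\overline{\chi(s)}\,ds$, if the limit exists; it exists for all $f\in Bap^2_{\mathcal A}(G)$ and all $\chi$. *)

(* Defs.v *)
From HB Require Import structures.
From mathcomp Require Import all_boot all_order all_algebra.
From mathcomp Require Import all_classical all_reals all_analysis.
From mathcomp Require Import complex.
Set Implicit Arguments.
Unset Strict Implicit.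
Unset Printing Implicit Defensive.
Import Order.TTheory GRing.Theory Num.Theory.
Import numFieldTopology.Exports numFieldNormedType.Exports.
Local Open Scope classical_set_scope.
Local Open Scope ring_scope.
Local Open Scope complex_scope.

(* R[i] receives its topology and norm from the numFieldType structure of
   R[i]^o, as the library does for its own number fields. *)
HB.instance Definition _ (R : realType) := PseudoPointedMetric.copy R[i] R[i]^o.
HB.instance Definition _ (R : realType) := NormedModule.copy R[i] R[i]^o.

(* measurableType asks for a distinguished point, which topologicalZmodType
   does not provide; we take 0. *)
Definition pointed_group (G : topologicalZmodType) : Type := G.
HB.instance Definition _ (G : topologicalZmodType) :=
  Choice.on (pointed_group G).
HB.instance Definition _ (G : topologicalZmodType) :=
  isPointed.Build (pointed_group G) (0 : G).

Notation borel G := (@g_sigma_algebraType (pointed_group G) (@open G)).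

Record haar_measure (R : realType) (G : topologicalZmodType)
    (mu : {measure set (borel G) -> \bar R}) : Prop := HaarMeasure {
  haar_invariant : forall (t : G) (B : set (borel G)), measurable B ->
    mu [set t + s | s in (B : set G)] = mu B ;
  haar_neq0 : (0 < mu setT)%E ;
  haar_compact : forall K : set G, compact K -> (mu K < +oo)%E ;
  haar_outer : forall B : set (borel G), measurable B ->
    mu B = ereal_inf [set mu U | U in [set U : set G | open U /\ B `<=` U]] ;
  haar_inner : forall U : set G, open U ->
    mu U = ereal_sup [set mu K | K in [set K : set G | compact K /\ K `<=` U]]
}.

Section VanHove.
Context (R : realType) (G : topologicalZmodType).
Variable mu : {measure set (borel G) -> \bar R}.

Definition van_hove_boundary (K A : set G) : set G :=
  (closure [set a + k | a in A & k in K] `\` A) `|`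
  ([set a - k | a in ~` A & k in K] `&` closure A).

Definition van_hove (A : (set G)^nat) : Prop :=
  (forall n, [/\ open (A n), precompact (A n) & (0 < mu (A n))%E]) /\
  (forall K : set G, compact K ->
    (mu (van_hove_boundary K (A n)) * (mu (A n))^-1)%E @[n --> \oo] --> 0%E).

End VanHove.

Section ComplexIntegral.
Context (R : realType) (G : topologicalZmodType).
Variable mu : {measure set (borel G) -> \bar R}.

Definition cmeasurable (f : G -> R[i]) : Prop :=
  measurable_fun setT (fun x : borel G => complex.Re (f x)) /\
  measurable_fun setT (fun x : borel G => complex.Im (f x)).

Definition cintegrable (D : set G) (f : G -> R[i]) : Prop :=
  mu.-integrable D (fun x : borel G => (complex.Re (f x))%:E) /\
  mu.-integrable D (fun x : borel G => (complex.Im (f x))%:E).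

Definition cintegral (D : set G) (f : G -> R[i]) : R[i] :=
  (\int[mu]_(x in (D : set (borel G))) complex.Re (f x)) +i*
  (\int[mu]_(x in (D : set (borel G))) complex.Im (f x)).

Definition mean (D : set G) (f : G -> R[i]) : R[i] :=
  ((fine (mu D))^-1)%:C * cintegral D f.

Definition L1loc (f : G -> R[i]) : Prop :=
  cmeasurable f /\ forall K : set G, compact K -> cintegrable K f.

Definition L2loc (f : G -> R[i]) : Prop :=
  cmeasurable f /\ forall K : set G, compact K ->
    (\int[mu]_(x in (K : set (borel G))) (Normc.normc (f x) ^+ 2)%:E < +oo)%E.

Definition Linfty (f : G -> R[i]) : Prop :=
  cmeasurable f /\
  (ess_sup_inf.ess_sup mu
     (fun x : borel G => (Normc.normc (f x))%:E) < +oo)%E.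

End ComplexIntegral.

Section DualGroup.
Context (R : realType) (G : topologicalZmodType).

Definition dual_group : set (G -> R[i]) :=
  [set chi : G -> R[i] | [/\ continuous chi,
                 forall x, `|chi x| = 1 &
                 forall x y, chi (x + y) = chi x * chi y]].

Definition trig_poly : set (G -> R[i]) :=
  [set p | exists n (c : 'I_n -> R[i]) (chi : 'I_n -> G -> R[i]),
     (forall i, dual_group (chi i)) /\
     (forall x, p x = \sum_(i < n) c i * chi i x)].

End DualGroup.

Section AlmostPeriodic.
Context (R : realType) (G : topologicalZmodType).
Variables (mu : {measure set (borel G) -> \bar R}) (A : (set G)^nat).

Definition besicovitch_norm (f : G -> R[i]) : \bar R :=
  (limn_esup (fun n => (mu (A n))^-1 *
     \int[mu]_(x in (A n : set (borel G))) (Normc.normc (f x) ^+ 2)%:E)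
   `^ 2^-1)%E.

Definition BL2 : set (G -> R[i]) :=
  [set f | L2loc mu f /\ (besicovitch_norm f < +oo)%E].

Definition Bap2 : set (G -> R[i]) :=
  [set f | BL2 f /\ forall e : R, 0 < e ->
     exists2 p, trig_poly p &
       (besicovitch_norm (fun x => (f x - p x)%R) < e%:E)%E].

Definition eberlein_integrand (f g : G -> R[i]) (t : G) : G -> R[i] :=
  fun s => f s * conjc (g (s - t)).

(* Integrability is required so that the means converging below are not the
   default values that the integral takes on non-integrable functions. *)
Definition eberlein_exists (f g : G -> R[i]) : Prop :=
  forall t : G,
    (forall n, cintegrable mu (A n) (eberlein_integrand f g t)) /\
    cvgn (fun n => mean mu (A n) (eberlein_integrand f g t)).

Definition eberlein (f g : G -> R[i]) : G -> R[i] :=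
  fun t => limn (fun n => mean mu (A n) (eberlein_integrand f g t)).

Definition FB_exists (chi f : G -> R[i]) : Prop :=
  L1loc mu f /\ cvgn (fun n => mean mu (A n) (fun s => f s * conjc (chi s))).

Definition FB (chi f : G -> R[i]) : R[i] :=
  limn (fun n => mean mu (A n) (fun s => f s * conjc (chi s))).

End AlmostPeriodic.

Section SAP.
Context (R : realType) (G : topologicalZmodType).

Definition translates (f : G -> R[i]) : set (G -> R[i]) :=
  [set (fun x => f (x - t)) | t in [set: G]].

(* The topology of {uniform G -> R[i]} is that of uniform convergence; the
   bounded uniformly continuous functions form a closed subset of it, on which
   it is the topology of the supremum norm. *)
Definition SAP : set (G -> R[i]) :=
  [set f | [/\ exists M : R, forall x, Normc.normc (f x) <= M,
     forall e : R, 0 < e ->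
       \forall h \near (0 : G), forall x, Normc.normc (f (x + h) - f x) < e &
     compact (closure (translates f : set {uniform G -> R[i]}))]].

End SAP.

(* Main.v *)
(* Since 2|x| <= e + |x|^2 / e, Besicovitch 2-almost periodicity of f and g only
   enters through their approximation by trigonometric polynomials p and q in the
   upper mean of |.|.  Because g is bounded, the van Hove condition makes that upper
   mean of |g - q| translation invariant, so the means defining [f, g](t) are
   uniformly in t close to those of [p, q](t).  Orthogonality of characters along
   the van Hove sequence evaluates the latter: [p, q] is a trigonometric polynomial
   in t, with coefficients a(p) conj(a(q)).  Hence [f, g] exists, is a uniform limit
   of trigonometric polynomials, and its Fourier-Bohr coefficients are the limits
   of a(p) conj(a(q)). *)
Require Import Defs.
From HB Require Import structures.
From mathcomp Require Import all_boot all_order all_algebra.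
From mathcomp Require Import all_classical all_reals all_analysis.
From mathcomp Require Import measurable_realfun ess_sup_inf.
From mathcomp Require Import complex ring lra.
Set Implicit Arguments.
Unset Strict Implicit.
Unset Printing Implicit Defensive.
Import Order.TTheory GRing.Theory Num.Theory.
Import numFieldTopology.Exports numFieldNormedType.Exports.
Local Open Scope classical_set_scope.
Local Open Scope ring_scope.

(** The two functions enter asymmetrically. Only [g] is translated, while [f] may be unbounded and
    is multiplied by nothing but the bounded [g]. The error is therefore split as (f - p) g + p (g -
    q), with [g] and [q] translated and conjugated, so that each difference is multiplied by a
    bounded function; the splitting through f (g - q) would not be controlled by first-power means.
    The van Hove condition gives a threshold in [n] for each [t] separately. What is uniform in [t]
    is the size of the bound, and this survives the passage to the limit, where uniform
    approximation of [f, g] is needed. [Linfty] bounds [g] only off a null set, whereas these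
    estimates use pointwise bounds. So [g] is first replaced by a truncation; translates of a null
    set are null for Haar measure, hence no mean changes for any [t]. *)

Local Notation normc := Normc.normc.
Local Notation Re := complex.Re.
Local Notation Im := complex.Im.

(** * Complex numbers *)

Section ComplexNorm.
Context {R : realType}.
Implicit Types (x y z : R[i]).

Lemma norm_normc x : `|x| = (normc x)%:C%C.
Proof. by []. Qed.

Lemma normc_ge0 x : 0 <= normc x.
Proof. by case: x => a b; exact: sqrtr_ge0. Qed.

Lemma normc_distC x y : normc (x - y) = normc (y - x).
Proof. by rewrite -normcN opprB. Qed.

Lemma normcB_le x y : normc (x - y) <= normc x + normc y.
Proof. by rewrite -(normcN y) le_normcD. Qed.

Lemma normc_dist_le z x y : normc (x - y) <= normc (x - z) + normc (z - y).
Proof. by rewrite -(subrKA z) le_normcD. Qed.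

Lemma normc_conj x : normc (conjc x) = normc x.
Proof. by case: x => a b /=; rewrite sqrrN. Qed.

Lemma ler_Re_normc x : `|Re x| <= normc x.
Proof.
by case: x => a b /=; rewrite -sqrtr_sqr ler_wsqrtr// lerDl sqr_ge0.
Qed.

Lemma ler_Im_normc x : `|Im x| <= normc x.
Proof.
by case: x => a b /=; rewrite -sqrtr_sqr ler_wsqrtr// lerDr sqr_ge0.
Qed.

Lemma normc_le_ReIm x : normc x <= `|Re x| + `|Im x|.
Proof.
case: x => a b /=; rewrite -[leRHS]ger0_norm ?addr_ge0// -sqrtr_sqr ler_wsqrtr//.
by rewrite sqrrD !real_normK ?num_real// addrAC lerDl mulrn_wge0// mulr_ge0.
Qed.

Lemma normc_sum (I : Type) (r : seq I) (P : pred I) (F : I -> R[i]) :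
  normc (\sum_(i <- r | P i) F i) <= \sum_(i <- r | P i) normc (F i).
Proof.
elim/big_ind2 : _ => [|x a y b xa yb|//]; first by rewrite Normc.normc0.
exact: le_trans (le_normcD _ _) (lerD xa yb).
Qed.

Lemma cvgcP (T : Type) (F : set_system T) (FF : Filter F) (f : T -> R[i]) (l : R[i]) :
  f @ F --> l <-> forall e : R, 0 < e -> \forall t \near F, normc (f t - l) < e.
Proof.
split=> [/cvgrPdist_lt fl e e0|fl].
  have e0C : 0 < e%:C%C by rewrite ltcR.
  near=> t; have : `|l - f t| < e%:C%C by near: t; exact: fl.
  by rewrite norm_normc ltcR normc_distC.
apply/cvgrPdist_lt => -[e b]; rewrite ltcE /= => /andP[/eqP -> e0].
near=> t; rewrite norm_normc -[Complex e 0]/(e%:C%C) ltcR normc_distC.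
by near: t; exact: fl.
Unshelve. all: by end_near. Qed.

Lemma cvgc_ReIm (T : Type) (F : set_system T) (FF : Filter F) (f : T -> R[i])
    (a b : R) :
  (fun t => Re (f t)) @ F --> a -> (fun t => Im (f t)) @ F --> b -> f @ F --> (a +i* b)%C.
Proof.
move=> /cvgrPdist_lt fa /cvgrPdist_lt fb; apply/cvgcP => e e0.
have e20 : 0 < e / 2 by rewrite divr_gt0.
near=> t; apply: (le_lt_trans (normc_le_ReIm _)).
rewrite [e]splitr ltrD//.
  have -> : Re (f t - (a +i* b)%C) = Re (f t) - a by case: (f t).
  rewrite distrC; near: t; exact: fa.
have -> : Im (f t - (a +i* b)%C) = Im (f t) - b by case: (f t).
rewrite distrC; near: t; exact: fb.
Unshelve. all: by end_near. Qed.

(** A Cauchy criterion in which the centre [l] may change with [e]: in its uses [l] is a value or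
    limit belonging to an approximating function. Completeness is that of the real line, applied to
    the two coordinates. *)
Lemma cvgc_cauchy (T : Type) (F : set_system T) (FF : ProperFilter F)
    (f : T -> R[i]) :
  (forall e : R, 0 < e -> exists l, \forall t \near F, normc (f t - l) < e) ->
  cvg (f @ F).
Proof.
move=> fc.
have re : cvg ((fun t => Re (f t)) @ F).
  apply/cauchy_cvgP/cauchy_exP => e /fc[l fl]; exists (Re l).
  apply: filterS fl => t ft; rewrite /ball/= distrC.
  have -> : Re (f t) - Re l = Re (f t - l) by case: (f t); case: (l).
  exact: le_lt_trans (ler_Re_normc _) ft.
have im : cvg ((fun t => Im (f t)) @ F).
  apply/cauchy_cvgP/cauchy_exP => e /fc[l fl]; exists (Im l).
  apply: filterS fl => t ft; rewrite /ball/= distrC.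
  have -> : Im (f t) - Im l = Im (f t - l) by case: (f t); case: (l).
  exact: le_lt_trans (ler_Im_normc _) ft.
by apply/cvg_ex; eexists; exact: cvgc_ReIm re im.
Qed.

Lemma cvgc_unique (T : Type) (F : set_system T) {FF : ProperFilter F}
    (f : T -> R[i]) (a b : R[i]) : f @ F --> a -> f @ F --> b -> a = b.
Proof. exact: (cvg_unique (@norm_hausdorff _ R[i])). Qed.

Lemma limnc_eq (f : nat -> R[i]) (a : R[i]) : f @ \oo --> a -> limn f = a.
Proof. exact: (cvg_lim (@norm_hausdorff _ R[i])). Qed.

Lemma normc_lim_le (T : Type) (F : set_system T) {FF : ProperFilter F}
    (f g : T -> R[i]) (a b : R[i]) (e : R) : f @ F --> a -> g @ F --> b ->
  (\forall t \near F, normc (f t - g t) <= e) -> normc (a - b) <= e.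
Proof.
move=> /cvgcP fa /cvgcP gb fge; apply/ler_addgt0Pr => d d0.
have d20 : 0 < d / 2 by rewrite divr_gt0.
have [t [H1 H2 H3]] : exists t, [/\ normc (f t - a) < d / 2,
    normc (g t - b) < d / 2 & normc (f t - g t) <= e].
  apply: (@filter_ex _ F); near=> t; split; near: t; [exact: fa|exact: gb|exact: fge].
apply: (le_trans (normc_dist_le (f t) _ _)); rewrite normc_distC.
rewrite addrC [d]splitr addrA; apply: lerD; last exact: ltW.
apply: (le_trans (normc_dist_le (g t) _ _)); apply: lerD => //; exact: ltW.
Unshelve. all: by end_near. Qed.

Lemma cvgcD (T : Type) (F : set_system T) {FF : Filter F}
    (f g : T -> R[i]) (a b : R[i]) :
  f @ F --> a -> g @ F --> b -> (fun t => f t + g t) @ F --> a + b.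
Proof.
move=> /cvgcP fa /cvgcP gb; apply/cvgcP => e e0.
have e20 : 0 < e / 2 by rewrite divr_gt0.
apply: filterS2 (fa _ e20) (gb _ e20) => t fta gtb.
by rewrite opprD addrACA [e]splitr (le_lt_trans (le_normcD _ _))// ltrD.
Qed.

Lemma cvgcZ (T : Type) (F : set_system T) {FF : Filter F}
    (f : T -> R[i]) (a c : R[i]) :
  f @ F --> a -> (fun t => c * f t) @ F --> c * a.
Proof.
move=> /cvgcP fa; apply/cvgcP => e e0.
have c0 : 0 < normc c + 1 by rewrite ltr_wpDl// normc_ge0.
apply: filterS (fa _ (divr_gt0 e0 c0)) => t.
rewrite ltr_pdivlMr// -mulrBr Normc.normcM; apply: le_lt_trans.
by rewrite mulrC ler_wpM2l ?normc_ge0// lerDl.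
Qed.

Lemma cvgc_sum (T : Type) (F : set_system T) {FF : Filter F} n
    (f : 'I_n -> T -> R[i]) (a : 'I_n -> R[i]) : (forall i, f i @ F --> a i) ->
  (fun t => \sum_(i < n) f i t) @ F --> \sum_(i < n) a i.
Proof.
elim: n f a => [|n IH] f a fa.
  rewrite big_ord0 (_ : (fun _ => _) = cst 0); first exact: cvg_cst.
  by apply/funext => t; rewrite big_ord0.
rewrite big_ord_recl.
under eq_fun do rewrite big_ord_recl.
by apply: cvgcD => //; apply: IH => i; exact: fa.
Qed.
End ComplexNorm.

(** * Characters and strongly almost periodic functions *)

Section Characters.
Context {R : realType} {G : topologicalZmodType}.
Implicit Types (chi psi p F : G -> R[i]) (x t : G) (e : R).

Lemma normc_dual chi x : dual_group chi -> normc (chi x) = 1.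
Proof. by move=> [_ /(_ x)]; rewrite norm_normc => -[]. Qed.

Lemma dual_neq0 chi x : dual_group chi -> chi x != 0.
Proof.
move=> /normc_dual - /(_ x) c1; apply/eqP => c0.
by move: c1; rewrite c0 Normc.normc0 => /esym/eqP; rewrite oner_eq0.
Qed.

Lemma dual0 chi : dual_group chi -> chi 0 = 1.
Proof.
move=> dchi; have [_ _ /(_ 0 0)] := dchi; rewrite addr0 => /eqP.
by rewrite -{1}[chi 0]mulr1 => /eqP/(mulfI (dual_neq0 _ dchi)).
Qed.

Lemma mul_conjc_normc1 (z : R[i]) : normc z = 1 -> z * conjc z = 1.
Proof.
by move=> z1; rewrite -sqr_normc norm_normc z1 expr1n.
Qed.

Lemma dualB chi x t : dual_group chi -> chi (x - t) = chi x * conjc (chi t).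
Proof.
move=> dchi; have [_ _ chiD] := dchi.
apply: (mulIf (dual_neq0 t dchi)); rewrite -chiD subrK -mulrA.
by rewrite [_ * chi t]mulrC mul_conjc_normc1 ?mulr1//; exact: normc_dual.
Qed.

Lemma trig_poly_bounded p : trig_poly p ->
  exists2 M : R, 0 <= M & forall x, normc (p x) <= M.
Proof.
move=> [n [c [chi [dchi pE]]]]; exists (\sum_(i < n) normc (c i)).
  by apply: sumr_ge0 => i _; exact: normc_ge0.
move=> x; rewrite pE (le_trans (normc_sum _ _ _))//; apply: ler_sum => i _.
by rewrite Normc.normcM normc_dual// mulr1.
Qed.

(** For a character, [chi (x + h) - chi x] has modulus [normc (chi h - 1)], which does not involve
    [x]; continuity at 0 of finitely many characters then suffices. *)
Lemma trig_poly_unif_continuous p e : trig_poly p -> 0 < e ->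
  \forall h \near (0 : G), forall x, normc (p (x + h) - p x) < e.
Proof.
move=> [n [c [chi [dchi pE]]]] e0.
(* The summand 1 keeps [B] positive when all coefficients vanish, and makes the final estimate
   strict. *)
pose B : R := 1 + \sum_(i < n) normc (c i).
have B0 : 0 < B by rewrite ltr_wpDr// sumr_ge0// => i _; exact: normc_ge0.
have : \forall h \near (0 : G), forall i, normc (chi i h - 1) < e / B.
  apply: filter_forall => i; have [chic _ _] := dchi i.
  have /cvgcP := chic 0; rewrite dual0//; apply; exact: divr_gt0.
apply: filterS => h hB x; rewrite !pE -sumrB.
apply: (le_lt_trans (normc_sum _ _ _)).
apply: (@le_lt_trans _ _ (\sum_(i < n) normc (c i) * (e / B))).
  apply: ler_sum => i _; have [_ _ chiD] := dchi i.
  rewrite chiD -mulrBr -[X in _ - X]mulr1 -mulrBr !Normc.normcM normc_dual// mul1r.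
  by rewrite ler_wpM2l ?normc_ge0// ltW.
rewrite -mulr_suml mulrCA gtr_pMr// ltr_pdivrMr// mul1r /B ltrDr//.
Qed.

Definition trig_approximable F :=
  forall e, 0 < e -> exists2 p, trig_poly p & forall x, normc (F x - p x) <= e.

(** Balls in [R[i]] have complex radii, but in the order of [R[i]] a positive number has imaginary
    part 0, so real radii describe the same neighbourhoods. *)
Lemma nbhs_uniformP (h : {uniform G -> R[i]}) (P : set {uniform G -> R[i]}) :
  nbhs h P <-> exists2 e : R, 0 < e &
    forall k, (forall x, normc (h x - k x) < e) -> P k.
Proof.
split=> [/uniform_nbhs[E [entE EP]]|[e e0 eP]].
  move: entE; rewrite -entourage_ballE => -[[e b]].
  rewrite /= ltcE /= => /andP[/eqP -> e0] eE; exists e => // k hk.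
  apply: EP => /= x _; apply: eE => /=; rewrite /ball/= norm_normc.
  by rewrite -[Complex e 0]/(e%:C%C) ltcR.
apply/uniform_nbhs.
have e0C : 0 < e%:C%C by rewrite ltcR.
exists [set xy | ball xy.1 e%:C%C xy.2]; split.
  exact: (entourage_ball _ (PosNum e0C)).
move=> k /= hk; apply: eP => x; have := hk x I.
by rewrite /ball/= norm_normc ltcR.
Qed.

(** The segment [- M, M] is compact, so the image filter has a cluster point, and an ultrafilter
    cannot avoid a neighbourhood of a cluster point. *)
Lemma ultra_bounded_cvg (T : Type) (U : set_system T) (UU : UltraFilter U)
    (phi : T -> R) (M : R) : (forall s, `|phi s| <= M) -> cvg (phi @ U).
Proof.
move=> phiM; have PU : ProperFilter U by exact: ultra_proper.
have [l [_ cl]] : `[- M, M] `&` cluster (phi @ U) !=set0.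
  apply: segment_compact; apply: (@filterE _ U) => s /=.
  by rewrite in_itv/= -ler_norml.
apply/cvg_ex; exists l; apply/cvgrPdist_lt => e e0.
have [//|UC] := in_ultra_setVsetC [set s | `|l - phi s| < e] UU.
have [] := cl [set y | ~ `|l - y| < e] (ball l e) UC (nbhsx_ballx l e e0).
by move=> y [].
Qed.

Lemma ultra_bounded_cvgc (T : Type) (U : set_system T) (UU : UltraFilter U)
    (phi : T -> R[i]) (M : R) : (forall s, normc (phi s) <= M) ->
  exists z : R[i], phi @ U --> z.
Proof.
move=> phiM.
have /cvg_ex[a ra] : cvg ((fun s => Re (phi s)) @ U).
  by apply: (@ultra_bounded_cvg _ _ _ _ M) => t; exact: le_trans (ler_Re_normc _) _.
have /cvg_ex[b rb] : cvg ((fun s => Im (phi s)) @ U).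
  by apply: (@ultra_bounded_cvg _ _ _ _ M) => t; exact: le_trans (ler_Im_normc _) _.
by exists (Complex a b); exact: cvgc_ReIm ra rb.
Qed.

(** Compactness is proved by showing that every ultrafilter on the hull converges. A translate
    [p (x - t)] of a trigonometric polynomial depends on [t] only through the finitely many bounded
    numbers [conjc (chi i t)], and these converge along an ultrafilter; hence the ultrafilter is
    Cauchy for uniform convergence. *)
Lemma trig_approximable_SAP F : trig_approximable F -> SAP F.
Proof.
move=> Fa; split.
- have [p tp Fp] := Fa 1 ltr01; have [M _ pM] := trig_poly_bounded tp.
  exists (1 + M) => x; rewrite -(subrK (p x) (F x)).
  by rewrite (le_trans (le_normcD _ _))// lerD.
- move=> e e0; have e30 : 0 < e / 3 by rewrite divr_gt0.
  have [p tp Fp] := Fa _ e30.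
  apply: filterS (trig_poly_unif_continuous tp e30) => h ph x.
  apply: (le_lt_trans (normc_dist_le (p (x + h)) _ _)).
  have -> : e = e / 3 + (e / 3 + e / 3) by field.
  rewrite ler_ltD//; apply: (le_lt_trans (normc_dist_le (p x) _ _)).
  by rewrite ltr_leD// normc_distC.
rewrite compact_ultra => U UU UT.
have PU : ProperFilter U by exact: ultra_proper.
have U_cauchy e : 0 < e -> exists k : G -> R[i],
    U [set h : {uniform G -> R[i]} | forall x, normc (h x - k x) < e].
  move=> e0; have e30 : 0 < e / 3 by rewrite divr_gt0.
  have [p [n [c [chi [dchi pE]]]] Fp] := Fa _ e30.
  (* Stated for all [h], with the value 0 outside the closure, so that choice yields a total
     function [tau] whose characters have limits along [U]. The closure itself belongs to [U], so
     the default value does no harm. *)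
  have near_translate (h : {uniform G -> R[i]}) : exists t, closure
      (translates F : set {uniform G -> R[i]}) h ->
      forall x, normc (h x - F (x - t)) < e / 3.
    have [clh|] := pselect (closure (translates F : set {uniform G -> R[i]}) h);
      last by exists 0.
    have [|k [[t _ <-] hk]] := clh [set k | forall x, normc (h x - k x) < e / 3].
      by apply/nbhs_uniformP; exists (e / 3).
    by exists t.
  have [tau tauP] := choice near_translate.
  have /choice[z zP] (i : 'I_n) : exists z : R[i],
      (fun h : {uniform G -> R[i]} => conjc (chi i (tau h))) @ U --> z.
    apply: (@ultra_bounded_cvgc _ _ _ _ 1) => h.
    by rewrite normc_conj normc_dual.
  pose B : R := 1 + \sum_(i < n) normc (c i).
  have B0 : 0 < B by rewrite ltr_wpDr// sumr_ge0// => i _; exact: normc_ge0.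
  (* This is the limit along [U] of [p (x - tau h)]. *)
  exists (fun x => \sum_(i < n) c i * chi i x * z i).
  have : U [set h : {uniform G -> R[i]} |
      forall i, normc (conjc (chi i (tau h)) - z i) < e / 3 / B].
    apply: filter_forall => i; have /cvgcP := zP i; apply.
    exact: divr_gt0.
  apply: filterS2 UT => h clh hz x.
  apply: (le_lt_trans (normc_dist_le (F (x - tau h)) _ _)).
  have -> : e = e / 3 + (e / 3 + e / 3) by field.
  rewrite ltr_leD//; first exact: tauP.
  apply: (le_trans (normc_dist_le (p (x - tau h)) _ _)).
  rewrite lerD// pE -sumrB (le_trans (normc_sum _ _ _))//.
  apply: (@le_trans _ _ (\sum_(i < n) normc (c i) * (e / 3 / B))).
    apply: ler_sum => i _; rewrite dualB// mulrA -mulrBr !Normc.normcM.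
    by rewrite normc_dual// mulr1 ler_wpM2l ?normc_ge0// ltW.
  rewrite -mulr_suml mulrCA ger_pMr// ler_pdivrMr// mul1r /B lerDr//.
(* The pointwise limit is constructed first; [U_cauchy] then upgrades the convergence to a uniform
   one. *)
have /choice[L UL] (x : G) :
    exists l : R[i], (fun h : {uniform G -> R[i]} => h x) @ U --> l.
  apply/cvg_ex; apply: cvgc_cauchy => e /U_cauchy[k Uk].
  by exists (k x); apply: filterS Uk => h; exact.
have U_L : U --> (L : {uniform G -> R[i]}).
  move=> P /nbhs_uniformP[e e0 eP].
  have e20 : 0 < e / 2 by rewrite divr_gt0.
  have [k Uk] := U_cauchy _ e20; apply: filterS (Uk) => h hk; apply: eP => x.
  apply: (le_lt_trans (normc_dist_le (k x) _ _)).
  rewrite [e]splitr ler_ltD//; last by rewrite normc_distC.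
  apply: (@normc_lim_le _ _ U _ (fun h => h x) (fun=> k x)).
  - exact: UL.
  - exact: cvg_cst.
  - by apply: filterS Uk => g gk; exact: ltW.
exists L; split => //; apply: closed_closure => B /U_L UB.
exact: filter_ex (filterI UT UB).
Qed.
End Characters.

(** * Haar measure and translations *)

Section BorelMeasurability.
Context {G : topologicalZmodType}.
Implicit Types (U K : set G) (t : G).

Lemma borel_open U : open U -> measurable (U : set (borel G)).
Proof. exact: sub_sigma_algebra. Qed.

Lemma borel_closed U : closed U -> measurable (U : set (borel G)).
Proof.
move=> cU; rewrite -(setCK U); apply: measurableC; apply: borel_open.
exact: closed_openC.
Qed.

Lemma borel_compact K : hausdorff_space G -> compact K -> measurable (K : set (borel G)).
Proof. by move=> hG /(compact_closed hG); exact: borel_closed. Qed.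

Lemma continuous_borel (R : realType) (h : G -> R) : continuous h ->
  measurable_fun [set: borel G] (h : borel G -> R).
Proof.
move=> /continuousP ch; apply: (measurability _ (RGenOpens.measurableE R)).
move=> _ [_ [a [b ->] <-]]; rewrite setTI; apply: borel_open; apply: ch.
exact: interval_open.
Qed.

Lemma continuous_subr t : continuous (fun x : G => x - t).
Proof.
move=> x; apply: (@continuous_comp G (G * G)%type G (fun x => (x, - t))
  (fun z => z.1 + z.2)); last exact: add_continuous.
by apply: cvg_pair => //; exact: cvg_cst.
Qed.

Lemma subr_borel t : measurable_fun [set: borel G] ((fun x => x - t) : borel G -> borel G).
Proof.
apply: (@measurability _ _ (borel G) (borel G) setT _ (@open G)) => //.
move=> _ [U oU <-]; rewrite setTI.
by apply: borel_open; move/continuousP : (@continuous_subr t); exact.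
Qed.

Lemma shift_borel (R : realType) (h : borel G -> R) t :
  measurable_fun [set: borel G] h ->
  measurable_fun [set: borel G] (fun x : borel G => h ((x : G) - t)).
Proof. by move=> mh; apply: (measurableT_comp mh); exact: subr_borel. Qed.
End BorelMeasurability.

Section HaarShift.
Context {R : realType} {G : topologicalZmodType}.
Variable mu : {measure set (borel G) -> \bar R}.
Hypothesis mu_haar : haar_measure mu.
Implicit Types (B : set (borel G)) (t : G).

Definition shift_set (B : set G) t : set (borel G) := [set x | B (x + t)].

Lemma measurable_shift_set B t : measurable B -> measurable (shift_set B t).
Proof.
move=> mB; have := subr_borel (- t) measurableT mB; rewrite setTI.
by under eq_fun do rewrite opprK.
Qed.

Lemma haar_shift B t : measurable B -> mu [set x | B ((x : G) - t)] = mu B.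
Proof.
move=> mB; rewrite -(haar_invariant mu_haar t mB); congr (mu _).
apply/seteqP; split=> [x /= Bx|_ [s Bs <-] /=].
  by exists ((x : G) - t) => //; rewrite addrC subrK.
by rewrite addrC addKr.
Qed.

(** Change of variables: by [haar_shift], the pushforward of [mu] under translation by [- t] is [mu]
    itself. *)
Lemma integral_haar_shift B (h : borel G -> R) t : measurable B ->
  measurable_fun setT h -> (forall x, 0 <= h x) ->
  (\int[mu]_(x in B) (h ((x : G) - t)%R)%:E =
   \int[mu]_(x in shift_set B t) (h x)%:E)%E.
Proof.
move=> mB mh h0; set Bt := shift_set B t.
have mBt : measurable Bt by exact: measurable_shift_set.
pose phi : borel G -> borel G := fun x => (x : G) - t.
have BE : phi @^-1` Bt = B.
  by apply/seteqP; split=> x; rewrite /phi/Bt/shift_set/= subrK.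
rewrite -[in LHS]BE; transitivity
  (\int[mu]_(x in phi @^-1` Bt) (((EFin \o h) \o phi) x))%E => //.
rewrite -(@ge0_integral_pushforward _ _ _ _ _ _ (subr_borel t)) //.
- apply: eq_measure_integral => [|? D mD _]; first exact: subr_borel.
  exact: haar_shift.
- by apply/measurable_EFinP; exact: measurable_funTS.
- by move=> y _; rewrite lee_fin.
Qed.
End HaarShift.

(** * Complex means *)

Section ComplexMeasurability.
Context {R : realType} {G : topologicalZmodType}.
Implicit Types (f g : G -> R[i]) (t : G).

Lemma ReM (x y : R[i]) : Re (x * y) = Re x * Re y - Im x * Im y.
Proof. by case: x; case: y. Qed.
Lemma ImM (x y : R[i]) : Im (x * y) = Re x * Im y + Im x * Re y.
Proof. by case: x; case: y. Qed.
Lemma ReD (x y : R[i]) : Re (x + y) = Re x + Re y.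
Proof. by case: x; case: y. Qed.
Lemma ImD (x y : R[i]) : Im (x + y) = Im x + Im y.
Proof. by case: x; case: y. Qed.
Lemma ReJ (x : R[i]) : Re (conjc x) = Re x.
Proof. by case: x. Qed.
Lemma ImJ (x : R[i]) : Im (conjc x) = - Im x.
Proof. by case: x. Qed.

Lemma cmeasurableD f g : cmeasurable f -> cmeasurable g ->
  cmeasurable (fun x => f x + g x).
Proof.
move=> [rf jf] [rg jg]; split.
  by under eq_fun do rewrite ReD; exact: measurable_funD.
by under eq_fun do rewrite ImD; exact: measurable_funD.
Qed.

Lemma cmeasurableM f g : cmeasurable f -> cmeasurable g ->
  cmeasurable (fun x => f x * g x).
Proof.
move=> [rf jf] [rg jg]; split.
  under eq_fun do rewrite ReM.
  by apply: measurable_funB; exact: measurable_funM.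
under eq_fun do rewrite ImM.
by apply: measurable_funD; exact: measurable_funM.
Qed.

Lemma cmeasurable_conj f : cmeasurable f -> cmeasurable (fun x => conjc (f x)).
Proof.
move=> [rf jf]; split; first by under eq_fun do rewrite ReJ.
under eq_fun do rewrite ImJ; exact: (measurableT_comp (@oppr_measurable _ _)).
Qed.

Lemma cmeasurable_cst (c : R[i]) : cmeasurable (fun _ : G => c).
Proof. by split; exact: measurable_cst. Qed.

Lemma cmeasurable_shift f t : cmeasurable f -> cmeasurable (fun x => f (x - t)).
Proof.
by move=> [rf jf]; split; [exact: (shift_borel _ rf)|exact: (shift_borel _ jf)].
Qed.

Lemma measurable_normc (D : set (borel G)) f :
  measurable_fun D (fun x : borel G => Re (f x)) ->
  measurable_fun D (fun x : borel G => Im (f x)) ->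
  measurable_fun D (fun x : borel G => normc (f x)).
Proof.
move=> rf jf; rewrite (_ : (fun x => _) =
    (fun x : borel G => Num.sqrt (Re (f x) ^+ 2 + Im (f x) ^+ 2))); last first.
  by apply/funext => x; case: (f x).
apply: measurableT_comp.
  by apply: continuous_measurable_fun; exact: sqrt_continuous.
by apply: measurable_funD; exact: measurable_funX.
Qed.

Lemma cmeasurable_normc f : cmeasurable f ->
  measurable_fun [set: borel G] (fun x : borel G => normc (f x)).
Proof.
by move=> [rf jf]; exact: measurable_normc.
Qed.

Lemma continuous_cmeasurable f : continuous f -> cmeasurable f.
Proof.
move=> cf; split; apply: continuous_borel => x.
  apply/cvgrPdist_lt => e e0; have /cvgcP/(_ e e0) := cf x.
  apply: filterS => y; rewrite normc_distC; apply: le_lt_trans.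
  by have := ler_Re_normc (f x - f y); case: (f x); case: (f y).
apply/cvgrPdist_lt => e e0; have /cvgcP/(_ e e0) := cf x.
apply: filterS => y; rewrite normc_distC; apply: le_lt_trans.
by have := ler_Im_normc (f x - f y); case: (f x); case: (f y).
Qed.
End ComplexMeasurability.

Section ComplexMean.
Context {R : realType} {G : topologicalZmodType}.
Variable mu : {measure set (borel G) -> \bar R}.
Variable D : set (borel G).
Hypotheses (mD : measurable D) (D0 : (0 < mu D)%E) (Doo : (mu D < +oo)%E).
Implicit Types (f g : G -> R[i]) (h : borel G -> R) (c : R[i]) (M : R).

Definition rmean h : R := (fine (mu D))^-1 * \int[mu]_(x in D) h x.

Let fD : 0 < fine (mu D).
Proof. by rewrite fine_gt0// D0. Qed.

Lemma integrable_bounded h M : measurable_fun setT h ->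
  (forall x, `|h x| <= M) -> mu.-integrable D (EFin \o h).
Proof.
move=> mh hM; apply: measurable_bounded_integrable => //.
  exact: measurable_funTS.
exists M; split; first exact: num_real.
by move=> K MK x _ /=; rewrite (le_trans (hM x))// ltW.
Qed.

Lemma rmeanD h k : mu.-integrable D (EFin \o h) -> mu.-integrable D (EFin \o k) ->
  rmean (fun x => h x + k x) = rmean h + rmean k.
Proof. by move=> ih ik; rewrite /rmean RintegralD// mulrDr. Qed.

Lemma rmeanZ (r : R) h : mu.-integrable D (EFin \o h) ->
  rmean (fun x => r * h x) = r * rmean h.
Proof. by move=> ih; rewrite /rmean RintegralZl// mulrCA. Qed.

Lemma rmean_cst (r : R) : rmean (fun=> r) = r.
Proof. by rewrite /rmean Rintegral_cst// mulrCA mulVf ?mulr1// gt_eqF. Qed.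

Lemma le_rmean h k : mu.-integrable D (EFin \o h) -> mu.-integrable D (EFin \o k) ->
  (forall x, D x -> h x <= k x) -> rmean h <= rmean k.
Proof.
by move=> ih ik hk; rewrite ler_wpM2l ?invr_ge0 ?(ltW fD)//; exact: le_Rintegral.
Qed.

Lemma meanE f : mean mu D f =
  Complex (rmean (fun x => Re (f x))) (rmean (fun x => Im (f x))).
Proof. by rewrite /mean /cintegral /rmean -complexr0/= /GRing.mul/= !mul0r subr0 addr0. Qed.

Lemma cintegrable_bounded f M : cmeasurable f -> (forall x, normc (f x) <= M) ->
  cintegrable mu D f.
Proof.
move=> [rf jf] fM; split.
  apply: (integrable_bounded rf) => x; exact: le_trans (ler_Re_normc _) (fM x).
apply: (integrable_bounded jf) => x; exact: le_trans (ler_Im_normc _) (fM x).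
Qed.

Lemma cintegrableD f g : cintegrable mu D f -> cintegrable mu D g ->
  cintegrable mu D (fun x => f x + g x).
Proof.
move=> [rf jf] [rg jg]; split.
  by under eq_fun do rewrite ReD EFinD; exact: integrableD.
by under eq_fun do rewrite ImD EFinD; exact: integrableD.
Qed.

Lemma cintegrable_normc f : cintegrable mu D f ->
  mu.-integrable D (fun x => (normc (f x))%:E).
Proof.
move=> [rf jf].
have mrf := (measurable_EFinP _ _).1 (measurable_int mu rf).
have mjf := (measurable_EFinP _ _).1 (measurable_int mu jf).
apply: (@le_integrable _ _ _ _ _ mD _
    (fun x => (`|Re (f x)|)%:E + (`|Im (f x)|)%:E)%E).
- apply/measurable_EFinP.
  exact: measurable_normc.
- move=> x _; rewrite -EFinD !abse_EFin lee_fin.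
  by rewrite [leLHS]ger0_norm ?normc_ge0// [leRHS]ger0_norm ?addr_ge0// normc_le_ReIm.
- by apply: integrableD => //; [exact: (integrable_norm rf)|exact: (integrable_norm jf)].
Qed.

Lemma le_cintegrable f h : measurable_fun D (fun x => Re (f x)) ->
  measurable_fun D (fun x => Im (f x)) -> mu.-integrable D (EFin \o h) ->
  (forall x, D x -> normc (f x) <= h x) -> cintegrable mu D f.
Proof.
move=> rf jf ih fh; split.
  apply: (le_integrable mD _ _ ih); first exact/measurable_EFinP.
  move=> x Dx; rewrite /= lee_fin (le_trans (ler_Re_normc _))//.
  by rewrite (le_trans (fh x Dx))// ler_norm.
apply: (le_integrable mD _ _ ih); first exact/measurable_EFinP.
move=> x Dx; rewrite /= lee_fin (le_trans (ler_Im_normc _))//.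
by rewrite (le_trans (fh x Dx))// ler_norm.
Qed.

Lemma cintegrableM_bounded f g M : cmeasurable f -> cintegrable mu D f ->
  cmeasurable g -> (forall x, normc (g x) <= M) ->
  cintegrable mu D (fun x => f x * g x).
Proof.
move=> mf intf mg gM; have [rfg jfg] := cmeasurableM mf mg.
apply: (@le_cintegrable _ (fun x => M * normc (f x))).
- exact: measurable_funTS.
- exact: measurable_funTS.
- exact: (integrableZl mD M (cintegrable_normc intf)).
- move=> x _; rewrite Normc.normcM mulrC ler_wpM2r ?normc_ge0//.
Qed.

Lemma cintegrableZ f c : cmeasurable f -> cintegrable mu D f ->
  cintegrable mu D (fun x => c * f x).
Proof.
move=> mf intf; under eq_fun do rewrite mulrC.
by apply: (@cintegrableM_bounded _ _ (normc c)) => //; exact: cmeasurable_cst.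
Qed.

Lemma meanD f g : cintegrable mu D f -> cintegrable mu D g ->
  mean mu D (fun x => f x + g x) = mean mu D f + mean mu D g.
Proof.
move=> [rf jf] [rg jg]; rewrite !meanE.
under [in LHS]eq_fun do rewrite ReD.
under [X in Complex _ (rmean X)]eq_fun do rewrite ImD.
by rewrite !rmeanD.
Qed.

Lemma meanZ f c : cintegrable mu D f ->
  mean mu D (fun x => c * f x) = c * mean mu D f.
Proof.
move=> [rf jf]; rewrite !meanE.
have Z (r : R) h : mu.-integrable D (fun x => (h x)%:E) ->
    mu.-integrable D (EFin \o (fun x => r * h x)).
  by move=> ih; exact: (integrableZl mD r ih).
case: c => a b; rewrite {3}/GRing.mul/=.
under [in LHS]eq_fun do rewrite ReM/= -mulNr.
under [X in Complex _ (rmean X)]eq_fun do rewrite ImM/=.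
rewrite !rmeanD ?rmeanZ//; try exact: Z.
by rewrite mulNr.
Qed.

(** Real and imaginary parts are bounded separately, which costs the factor 2. All later estimates
    only need some absolute constant here. *)
Lemma mean_norm_le f : cintegrable mu D f ->
  normc (mean mu D f) <= 2 * rmean (fun x => normc (f x)).
Proof.
move=> intf; have [rf jf] := intf; have nf := cintegrable_normc intf.
rewrite meanE (le_trans (normc_le_ReIm _))//= mulr_natl mulr2n lerD//.
  rewrite /rmean normrM ger0_norm ?invr_ge0 ?(ltW fD)// ler_wpM2l ?invr_ge0 ?(ltW fD)//.
  apply: (le_trans (le_normr_Rintegral mD rf)); apply: le_Rintegral => //.
    exact: (integrable_norm rf).
  by move=> x _; exact: ler_Re_normc.
rewrite /rmean normrM ger0_norm ?invr_ge0 ?(ltW fD)// ler_wpM2l ?invr_ge0 ?(ltW fD)//.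
apply: (le_trans (le_normr_Rintegral mD jf)); apply: le_Rintegral => //.
  exact: (integrable_norm jf).
by move=> x _; exact: ler_Im_normc.
Qed.

Lemma meanB_norm_le f g : cmeasurable g -> cintegrable mu D f ->
  cintegrable mu D g ->
  normc (mean mu D f - mean mu D g) <= 2 * rmean (fun x => normc (f x - g x)).
Proof.
move=> mg intf intg.
have intNg : cintegrable mu D (fun x => -1 * g x) by exact: cintegrableZ.
have := mean_norm_le (cintegrableD intf intNg).
rewrite meanD// meanZ// mulN1r.
by under [X in 2 * rmean X]eq_fun do rewrite mulN1r.
Qed.

Lemma mean_sum n (F : 'I_n -> G -> R[i]) : (forall i, cintegrable mu D (F i)) ->
  cintegrable mu D (fun x => \sum_(i < n) F i x) /\
  mean mu D (fun x => \sum_(i < n) F i x) = \sum_(i < n) mean mu D (F i).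
Proof.
elim: n F => [|n IH] F intF.
  under eq_fun do rewrite big_ord0; rewrite big_ord0; split.
    by split; exact: integrable0.
  by rewrite meanE/= !rmean_cst.
have [i1 i2] := IH (fun i => F (lift ord0 i)) (fun i => intF _).
under eq_fun do rewrite big_ord_recl; rewrite big_ord_recl; split.
  exact: cintegrableD.
by rewrite meanD// i2.
Qed.

End ComplexMean.

(** * Van Hove sequences and orthogonality of characters *)

Section VanHoveMeans.
Context {R : realType} {G : topologicalZmodType}.
Hypothesis G_hausdorff : hausdorff_space G.
Variable mu : {measure set (borel G) -> \bar R}.
Hypothesis mu_haar : haar_measure mu.
Variable A : (set G)^nat.
Hypothesis A_vH : van_hove mu A.
Implicit Types (t : G) (e : R) (n : nat).

Lemma vH_measurable n : measurable (A n : set (borel G)).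
Proof. by have [/(_ n)[oA _ _] _] := A_vH; exact: borel_open. Qed.

Lemma vH_gt0 n : (0 < mu (A n))%E.
Proof. by have [/(_ n)[]] := A_vH. Qed.

Lemma vH_compact n : compact (closure (A n)).
Proof. by have [/(_ n)[_ + _] _] := A_vH; rewrite precompactE. Qed.

Lemma vH_lty n : (mu (A n) < +oo)%E.
Proof.
apply: le_lt_trans (haar_compact mu_haar (@vH_compact n)).
apply: le_measure; rewrite ?inE.
- exact: vH_measurable.
- by apply: borel_compact => //; exact: vH_compact.
- exact: subset_closure.
Qed.

Lemma vH_fin n : mu (A n) = (fine (mu (A n)))%:E.
Proof. by rewrite fineK// ge0_fin_numE// vH_lty. Qed.

Lemma vH_fine_gt0 n : 0 < fine (mu (A n)).
Proof. by rewrite fine_gt0// vH_gt0 vH_lty. Qed.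

(** The van Hove condition is used with [K] the single point [- t]: then [A n + K] is the translate
    in question, and its part outside [A n] lies in the first half of the boundary. *)
Lemma vH_shift_diff t e : 0 < e -> \forall n \near \oo,
  (mu (shift_set (A n) t `\` A n) <= e%:E * mu (A n))%E.
Proof.
move=> e0; pose bd n : set (borel G) := van_hove_boundary [set - t] (A n).
have [_ /(_ [set - t] (@compact_set1 _ _))] := A_vH.
move=> /fine_cvgP[Ffin /cvgrPdist_lt/(_ e e0)] Fe.
near=> n.
have An := vH_fine_gt0 n.
have mAt : measurable (shift_set (A n) t).
  by apply: measurable_shift_set; exact: vH_measurable.
have mB : measurable (bd n).
  apply: measurableU; first apply: measurableD.
  - by apply: borel_closed; exact: closed_closure.
  - exact: vH_measurable.
  - apply: measurableI; last by apply: borel_closed; exact: closed_closure.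
    rewrite (_ : [set _ | _ in _ & _ in _] = (fun x => x - t) @^-1` (~` A n)).
      apply: borel_closed; apply: preimage_closed => [x _|].
        exact: continuous_subr.
      by apply: open_closedC; have [/(_ n)[]] := A_vH.
    apply/seteqP; split=> [x [a Aa [k -> <-]]|x nAx] /=; first by rewrite opprK addrK.
    by exists (x - t) => //; exists (- t) => //; rewrite opprK subrK.
apply: (@le_trans _ _ (mu (bd n))).
  apply: le_measure; rewrite ?inE//; first by apply: measurableD => //; exact: vH_measurable.
  move=> x [Axt nAx]; left; split=> //; apply: subset_closure.
  by exists (x + t) => //; exists (- t) => //; rewrite addrK.
rewrite (vH_fin n) -EFinM.
have : `|0 - fine (mu (bd n) * (mu (A n))^-1)%E| < e.
  by near: n.
have : (mu (bd n) * (mu (A n))^-1)%E \is a fin_num.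
  by near: n.
rewrite (vH_fin n) inver gt_eqF//.
have : (0 <= mu (bd n))%E by exact: measure_ge0.
case: (mu (bd n)) => [b||//].
- rewrite lee_fin => b0 _; rewrite -EFinM /= sub0r normrN ger0_norm.
    by rewrite ltr_pdivrMr// lee_fin => /ltW.
  by rewrite divr_ge0// ltW.
(* A boundary of infinite measure is excluded, because the quotient is eventually finite. *)
- by rewrite gt0_mulye// lte_fin invr_gt0.
Unshelve. all: by end_near. Qed.

Let mA := vH_measurable.
Let A0 := vH_gt0.
Let Aoo := vH_lty.

(** Shifting the integrand amounts to integrating over a translate of [A n]. As [h] is nonnegative,
    enlarging the domain to the union with [A n] only increases the integral, so the excess is at
    most [M] times the measure in [vH_shift_diff]. *)
Lemma rmean_shift_le (h : borel G -> R) (M : R) t e :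
  measurable_fun setT h -> (forall x, 0 <= h x <= M) -> 0 < e ->
  \forall n \near \oo,
    rmean mu (A n) (fun x => h ((x : G) - t)) <= rmean mu (A n) h + e.
Proof.
move=> mh hM e0.
have h0 x : 0 <= h x by have /andP[] := hM x.
have hM' x : h x <= M by have /andP[] := hM x.
have M0 : 0 <= M by exact: le_trans (h0 0) (hM' 0).
have M10 : 0 < M + 1 by rewrite ltr_wpDl.
near=> n.
have An := vH_fine_gt0 n.
have ih : mu.-integrable (A n) (EFin \o h).
  by apply: (@integrable_bounded _ _ _ _ _ _ _ M) => // x; rewrite ger0_norm.
have iht : mu.-integrable (A n) (EFin \o (fun x : borel G => h ((x : G) - t))).
  apply: (@integrable_bounded _ _ _ _ _ _ _ M) => //; first exact: shift_borel.
  by move=> x; rewrite ger0_norm.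
pose At := shift_set (A n) t.
have mAt : measurable At by exact: measurable_shift_set.
suff : (\int[mu]_(x in (A n : set (borel G))) (h ((x : G) - t)%R)%:E <=
    \int[mu]_(x in (A n : set (borel G))) (h x)%:E + (e * fine (mu (A n)))%:E)%E.
  rewrite -(fineK (integrable_fin_num (mA n) iht)).
  rewrite -(fineK (integrable_fin_num (mA n) ih)) -EFinD lee_fin.
  rewrite -(ler_pM2l (x := (fine (mu (A n)))^-1)) ?invr_gt0// => /le_trans; apply.
  by rewrite mulrDr [e * _]mulrC mulKf ?gt_eqF.
rewrite integral_haar_shift// -/At.
apply: (@le_trans _ _ (\int[mu]_(x in A n `|` (At `\` A n)) (h x)%:E)%E).
  apply: ge0_subset_integral => //.
  - by apply: measurableU => //; exact: measurableD.
  - by apply/measurable_EFinP; exact: measurable_funTS.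
  - by move=> x _; rewrite lee_fin.
  - by move=> x Ax; have [|] := pselect (A n x); [left|right].
rewrite ge0_integral_setU//; last 4 first.
- exact: measurableD.
- by apply/measurable_EFinP; exact: measurable_funTS.
- by move=> x _; rewrite lee_fin.
- by rewrite disj_set2E setDIK.
apply: leeD2l.
apply: (@le_trans _ _ (\int[mu]_(x in At `\` A n) cst M%:E x)%E).
  apply: ge0_le_integral => //.
  - exact: measurableD.
  - by move=> x _; rewrite lee_fin.
  - by apply/measurable_EFinP; exact: measurable_funTS.
  - by move=> x _; rewrite lee_fin.
rewrite integral_cst; last exact: measurableD.
(* Dividing by [M + 1] instead of [M] also covers [M = 0]. *)
apply: (@le_trans _ _ (M%:E * ((e / (M + 1))%:E * mu (A n)))%E).
  apply: lee_wpmul2l; first by rewrite lee_fin.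
  by rewrite /At; near: n; apply: vH_shift_diff; exact: divr_gt0.
rewrite (vH_fin n) -!EFinM lee_fin mulrA ler_wpM2r ?(ltW An)//.
by rewrite mulrCA ger_pMr// ler_pdivrMr// mul1r lerDl.
Unshelve. all: by end_near. Qed.

(** The one-sided bound [rmean_shift_le] is applied to [M + u] and to [M - u], both with values in
    [0, 2M]; the constant [M] cancels, leaving the two inequalities for [u]. *)
Lemma rmean_shift_cvg (u : borel G -> R) (M : R) t e :
  measurable_fun setT u -> (forall x, `|u x| <= M) -> 0 < e ->
  \forall n \near \oo,
    `|rmean mu (A n) (fun x => u ((x : G) - t)) - rmean mu (A n) u| <= e.
Proof.
move=> mdu uM e0.
have iu n : mu.-integrable (A n) (EFin \o u).
  exact: (@integrable_bounded _ _ _ _ _ _ _ M).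
have iut n : mu.-integrable (A n) (EFin \o (fun x : borel G => u ((x : G) - t))).
  apply: (@integrable_bounded _ _ _ _ _ _ _ M) => //; exact: shift_borel.
have ic n : mu.-integrable (A n) (EFin \o (fun _ : borel G => M)).
  by apply: (@integrable_bounded _ _ _ _ _ _ _ `|M|).
have Nu v n : mu.-integrable (A n) (EFin \o v) ->
    mu.-integrable (A n) (EFin \o (fun x => -1 * v x)).
  by move=> iv; exact: (integrableZl (mA n) (-1) iv).
have H1 : \forall n \near \oo, rmean mu (A n) (fun x => M + u ((x : G) - t)) <=
    rmean mu (A n) (fun x => M + u x) + e.
  apply: (@rmean_shift_le (fun x => M + u x) (M + M)) => //.
    by apply: measurable_funD => //; exact: measurable_cst.
  move=> x; move: (uM x); rewrite ler_norml => /andP[a b].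
  by apply/andP; split; lra.
have H2 : \forall n \near \oo, rmean mu (A n) (fun x => M + -1 * u ((x : G) - t)) <=
    rmean mu (A n) (fun x => M + -1 * u x) + e.
  apply: (@rmean_shift_le (fun x => M + -1 * u x) (M + M)) => //.
    apply: measurable_funD; first exact: measurable_cst.
    by apply: measurable_funM => //; exact: measurable_cst.
  move=> x; move: (uM x); rewrite ler_norml => /andP[a b].
  by apply/andP; split; lra.
apply: filterS2 H1 H2 => n.
rewrite !rmeanD//; try exact: Nu.
rewrite !rmeanZ// !rmean_cst// => a b.
by rewrite ler_norml; apply/andP; split; lra.
Qed.

Lemma mean_shift_cvg (f : G -> R[i]) (M : R) t : cmeasurable f ->
  (forall x, normc (f x) <= M) -> forall e, 0 < e -> \forall n \near \oo,
  normc (mean mu (A n) (fun x => f (x - t)) - mean mu (A n) f) < e.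
Proof.
move=> [rf jf] fM e e0; have e30 : 0 < e / 3 by rewrite divr_gt0.
have H1 := @rmean_shift_cvg (fun x => Re (f x)) M t _ rf
  (fun x => le_trans (ler_Re_normc _) (fM x)) e30.
have H2 := @rmean_shift_cvg (fun x => Im (f x)) M t _ jf
  (fun x => le_trans (ler_Im_normc _) (fM x)) e30.
apply: filterS2 H1 H2 => n H1 H2.
rewrite !meanE (le_lt_trans (normc_le_ReIm _))//=.
by apply: (le_lt_trans (lerD H1 H2)); lra.
Qed.

Lemma dual_cmeasurable (chi : G -> R[i]) : dual_group chi -> cmeasurable chi.
Proof. by move=> [cchi _ _]; exact: continuous_cmeasurable. Qed.

(** Translating [chi] by [t] multiplies its mean by [conjc (chi t)], yet changes it by an amount
    tending to 0. If [chi t] differs from 1, the mean times the nonzero constant [c] tends to 0,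
    hence so does the mean. *)
Lemma mean_character_cvg (chi : G -> R[i]) : dual_group chi ->
  mean mu (A n) chi @[n --> \oo] --> (if `[< forall x, chi x = 1 >] then 1 else 0 : R[i]).
Proof.
move=> dchi; case: asboolP => [chi1|].
  rewrite (_ : (fun n => _) = cst 1); first exact: cvg_cst.
  apply/funext => n; rewrite (_ : chi = fun=> 1) ?meanE/= ?rmean_cst//.
  exact/funext.
move=> /existsNP[t chit].
pose c := conjc (chi t) - 1.
have c0 : 0 < normc c.
  rewrite lt_neqAle normc_ge0 andbT eq_sym; apply/eqP => /Normc.eq0_normc.
  move=> /eqP; rewrite subr_eq0 => /eqP ct; apply: chit.
  by rewrite -(conjcK (chi t)) ct conjc1.
have chiM x : normc (chi x) <= 1 by rewrite normc_dual.
apply/cvgcP => e e0; rewrite -/(A).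
have := mean_shift_cvg t (dual_cmeasurable dchi) chiM (mulr_gt0 e0 c0).
apply: filterS => n; rewrite subr0.
under [X in mean _ _ X - _]eq_fun do rewrite dualB// mulrC.
have ic : cintegrable mu (A n) chi.
  by apply: (cintegrable_bounded _ _ _ chiM) => //; exact: dual_cmeasurable.
by rewrite meanZ// -{2}[mean _ _ _]mul1r -mulrBl Normc.normcM mulrC ltr_pM2r.
Qed.

Definition dirac_dual (chi psi : G -> R[i]) : R[i] :=
  if `[< chi = psi >] then 1 else 0.

(** The product of [chi] with the conjugate of [psi] is again a character, and it is trivial exactly
    when [chi = psi]. *)
Lemma mean_orthogonality (chi psi : G -> R[i]) : dual_group chi ->
  dual_group psi -> mean mu (A n) (fun x => chi x * conjc (psi x)) @[n --> \oo] -->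
  dirac_dual chi psi.
Proof.
move=> dchi dpsi; have [cchi nchi chiD] := dchi; have [cpsi npsi psiD] := dpsi.
have dq : dual_group (fun x => chi x * conjc (psi x)).
  split=> [x|x|x y].
  - have /cvgcP cc := cchi x; have /cvgcP cp := cpsi x.
    apply/cvgcP => e e0; have e20 : 0 < e / 2 by rewrite divr_gt0.
    apply: filterS2 (cc _ e20) (cp _ e20) => y ye yp.
    rewrite -(subrKA (chi y * conjc (psi x))) -mulrBr -mulrBl.
    apply: (le_lt_trans (le_normcD _ _)); rewrite !Normc.normcM normc_conj.
    rewrite (normc_dual _ dchi) (normc_dual _ dpsi) mulr1 mul1r addrC [e]splitr ltrD//.
    by rewrite -rmorphB normc_conj.
  - by rewrite normrM nchi norm_normc normc_conj normc_dual// mul1r.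
  - by rewrite chiD psiD rmorphM/= mulrACA.
have := mean_character_cvg dq; rewrite /dirac_dual.
suff -> : `[< forall x, chi x * conjc (psi x) = 1 >] = `[< chi = psi >] by [].
apply: asbool_equiv_eq; split=> [h|-> x].
  apply/funext => x; rewrite -[LHS]mulr1 -(mul_conjc_normc1 (normc_dual x dpsi)).
  by rewrite [psi x * _]mulrC mulrA h mul1r.
by rewrite mul_conjc_normc1// normc_dual.
Qed.

End VanHoveMeans.

Lemma unif_continuous_continuous (R : realType) (G : topologicalZmodType)
  (F : G -> R[i]) : (forall e : R, 0 < e ->
       \forall h \near (0 : G), forall x, normc (F (x + h) - F x) < e) ->
  continuous F.
Proof.
move=> Fu x; apply/cvgcP => e e0.
have /(_ x) := @continuous_subr G x; rewrite /continuous_at subrr => xc.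
have : \forall y \near x, forall z, normc (F (z + (y - x)) - F z) < e.
  exact: (xc _ (Fu e e0)).
by apply: filterS => y /(_ x); rewrite (addrC x) subrK.
Qed.

(** * Fourier-Bohr coefficients and Eberlein convolution of trigonometric polynomials *)

Section TrigMeans.
Context {R : realType} {G : topologicalZmodType}.
Hypothesis G_hausdorff : hausdorff_space G.
Variable mu : {measure set (borel G) -> \bar R}.
Hypothesis mu_haar : haar_measure mu.
Variable A : (set G)^nat.
Hypothesis A_vH : van_hove mu A.
Implicit Types (t : G) (e : R) (n : nat) (f g p q chi : G -> R[i]).

Let mA n : measurable (A n : set (borel G)).
Proof. exact: (vH_measurable A_vH). Qed.
Let A0 n : (0 < mu (A n))%E.
Proof. exact: (vH_gt0 A_vH). Qed.
Let Aoo n : (mu (A n) < +oo)%E.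
Proof. exact: (vH_lty G_hausdorff mu_haar A_vH). Qed.
Let dual_meas chi : dual_group chi -> cmeasurable chi.
Proof. exact: dual_cmeasurable. Qed.

(** The Fourier-Bohr coefficient at [psi]. A sum is taken because [trig_poly] allows the same
    character to occur several times. *)
Definition trig_coef m (c : 'I_m -> R[i]) (chi : 'I_m -> G -> R[i]) psi : R[i] :=
  \sum_(i < m) c i * dirac_dual (chi i) psi.

Lemma mean_trig_cvg m (c : 'I_m -> R[i]) (chi : 'I_m -> G -> R[i]) p psi :
  (forall i, dual_group (chi i)) -> (forall x, p x = \sum_(i < m) c i * chi i x) ->
  dual_group psi ->
  mean mu (A n) (fun x => p x * conjc (psi x)) @[n --> \oo] --> trig_coef c chi psi.
Proof.
move=> dchi pE dpsi.
have icp i n : cintegrable mu (A n) (fun x => chi i x * conjc (psi x)).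
  apply: (@cintegrable_bounded _ _ _ _ (mA n) (Aoo n) _ 1) => //.
    by apply: cmeasurableM; [|apply: cmeasurable_conj]; exact: dual_meas.
  by move=> x; rewrite Normc.normcM normc_conj !(normc_dual _ dpsi) normc_dual// mulr1.
have mcp i : cmeasurable (fun x => chi i x * conjc (psi x)).
  by apply: cmeasurableM; [|apply: cmeasurable_conj]; exact: dual_meas.
rewrite (_ : (fun n => _) = (fun n => \sum_(i < m) c i *
    mean mu (A n) (fun x => chi i x * conjc (psi x)))).
  by apply: cvgc_sum => i; apply: cvgcZ; exact: mean_orthogonality.
apply/funext => n.
have -> : (fun x => p x * conjc (psi x)) =
    (fun x => \sum_(i < m) c i * (chi i x * conjc (psi x))).
  by apply/funext => x; rewrite pE mulr_suml; apply: eq_bigr => i _; rewrite mulrA.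
have [|_ ->] := @mean_sum _ _ mu (A n) (mA n) (A0 n) (Aoo n) m
  (fun i x => c i * (chi i x * conjc (psi x))).
  by move=> i; exact: cintegrableZ.
by apply: eq_bigr => i _; rewrite meanZ.
Qed.

Lemma trig_poly_cmeasurable p : trig_poly p -> cmeasurable p.
Proof.
move=> tp; apply: continuous_cmeasurable; apply: unif_continuous_continuous => e e0.
exact: trig_poly_unif_continuous.
Qed.

(** Since [psi j (s - t)] factors into a function of [s] and one of [t], the mean is a finite sum of
    [conjc (d j) * psi j t] times the mean of [p] against [psi j]. The last clause speaks of
    arbitrary limits [a] and [b], so that it can be used without the representations of [p] and [q]
    chosen here. *)
Lemma eberlein_trig p q : trig_poly p -> trig_poly q ->
  exists E, [/\ trig_poly E,
    (forall t, mean mu (A n) (eberlein_integrand p q t) @[n --> \oo] --> E t) &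
    forall chi (a b : R[i]), dual_group chi ->
      mean mu (A n) (fun x => p x * conjc (chi x)) @[n --> \oo] --> a ->
      mean mu (A n) (fun x => q x * conjc (chi x)) @[n --> \oo] --> b ->
      mean mu (A n) (fun x => E x * conjc (chi x)) @[n --> \oo] --> a * conjc b].
Proof.
move=> tp tq; have mp := trig_poly_cmeasurable tp.
have [P _ pP] := trig_poly_bounded tp.
have [m [c [chi [dchi pE]]]] := tp; have [l [d [psi [dpsi qE]]]] := tq.
pose w j := conjc (d j) * trig_coef c chi (psi j).
exists (fun t => \sum_(j < l) w j * psi j t); split.
- by exists l, w, psi.
- move=> t.
  have mpp j : cmeasurable (fun s => p s * conjc (psi j s)).
    by apply: cmeasurableM => //; apply: cmeasurable_conj; exact: dual_meas.
  have ipp j n : cintegrable mu (A n) (fun s => p s * conjc (psi j s)).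
    apply: (@cintegrable_bounded _ _ _ _ (mA n) (Aoo n) _ P) => // x.
    by rewrite Normc.normcM normc_conj (normc_dual _ (dpsi j)) mulr1.
  rewrite (_ : (fun n => _) = (fun n => \sum_(j < l) (conjc (d j) * psi j t) *
      mean mu (A n) (fun s => p s * conjc (psi j s)))).
    apply: cvgc_sum => j; rewrite /w mulrAC.
    by apply: cvgcZ; exact: mean_trig_cvg.
  apply/funext => n.
  have -> : eberlein_integrand p q t = (fun s => \sum_(j < l)
      (conjc (d j) * psi j t) * (p s * conjc (psi j s))).
    apply/funext => s; rewrite /eberlein_integrand qE rmorph_sum mulr_sumr.
    apply: eq_bigr => j _; rewrite dualB// !rmorphM/= conjcK.
    ring.
  have [|_ ->] := @mean_sum _ _ mu (A n) (mA n) (A0 n) (Aoo n) l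
    (fun j s => (conjc (d j) * psi j t) * (p s * conjc (psi j s))).
    by move=> j; exact: cintegrableZ.
  by apply: eq_bigr => j _; rewrite meanZ.
move=> xi a b dxi pa qb.
rewrite (cvgc_unique pa (mean_trig_cvg dchi pE dxi)).
rewrite (cvgc_unique qb (mean_trig_cvg dpsi qE dxi)).
(* Only the indices with [psi j = xi] contribute, and for these the factor [trig_coef c chi (psi j)]
   in [w j] is the one at [xi]. *)
have -> : trig_coef c chi xi * conjc (trig_coef d psi xi) = trig_coef w psi xi.
  rewrite /trig_coef rmorph_sum mulr_sumr; apply: eq_bigr => j _.
  rewrite rmorphM/= /w /dirac_dual; case: asboolP => [->|_].
    by rewrite conjc1 !mulr1 mulrC.
  by rewrite conjc0 !mulr0.
exact: mean_trig_cvg.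
Qed.
End TrigMeans.

(** * The twisted Eberlein convolution with a bounded function *)

Section BoundedCase.
Context {R : realType} {G : topologicalZmodType}.
Hypothesis G_hausdorff : hausdorff_space G.
Variable mu : {measure set (borel G) -> \bar R}.
Hypothesis mu_haar : haar_measure mu.
Variable A : (set G)^nat.
Hypothesis A_vH : van_hove mu A.
Implicit Types (t : G) (e : R) (n : nat) (f g p q chi : G -> R[i]).

Let mA n : measurable (A n : set (borel G)).
Proof. exact: (vH_measurable A_vH). Qed.
Let A0 n : (0 < mu (A n))%E.
Proof. exact: (vH_gt0 A_vH). Qed.
Let Aoo n : (mu (A n) < +oo)%E.
Proof. exact: (vH_lty G_hausdorff mu_haar A_vH). Qed.

(** Approximability by trigonometric polynomials in the first-power Besicovitch seminorm, with the
    upper limit expressed by an eventual bound. Integrability on each [A n] makes the means genuine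
    integrals. *)
Definition mean_approximable f := [/\ cmeasurable f,
  forall n, cintegrable mu (A n) f &
  forall e, 0 < e -> exists2 p, trig_poly p &
    \forall n \near \oo, rmean mu (A n) (fun x => normc (f x - p x)) < e].

Lemma mean_diffM_le f p g (M : R) n : cmeasurable f -> cmeasurable p ->
  cmeasurable g -> cintegrable mu (A n) f -> cintegrable mu (A n) p ->
  (forall x, normc (g x) <= M) ->
  normc (mean mu (A n) (fun x => f x * g x) - mean mu (A n) (fun x => p x * g x)) <=
  2 * (M * rmean mu (A n) (fun x => normc (f x - p x))).
Proof.
move=> mf mp mg intf intp gM.
have ifg := cintegrableM_bounded (mA n) mf intf mg gM.
have ipg := cintegrableM_bounded (mA n) mp intp mg gM.
apply: (le_trans (meanB_norm_le (mA n) (A0 n) (Aoo n) (cmeasurableM mp mg) ifg ipg)).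
have ifp : cintegrable mu (A n) (fun x => f x - p x).
  have := cintegrableD (mA n) intf (cintegrableZ (mA n) (-1) mp intp).
  by under eq_fun do rewrite mulN1r.
have mfp : cmeasurable (fun x => f x - p x).
  have := cmeasurableD mf (cmeasurableM (cmeasurable_cst (-1)) mp).
  by under eq_fun do rewrite mulN1r.
have nfp := cintegrable_normc (mA n) ifp.
rewrite ler_wpM2l// -(rmeanZ (mA n))//; apply: (le_rmean (mA n) (A0 n) (Aoo n)).
- have := cintegrable_normc (mA n) (cintegrableM_bounded (mA n) mfp ifp mg gM).
  by under [X in _.-integrable _ X -> _]eq_fun do rewrite mulrBl.
- exact: (integrableZl (mA n) M nfp).
- by move=> x _; rewrite -mulrBl Normc.normcM mulrC ler_wpM2r// normc_ge0.
Qed.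

Lemma trig_poly_cintegrable p n : trig_poly p -> cintegrable mu (A n) p.
Proof.
move=> tp; have [P _ pP] := trig_poly_bounded tp.
exact: (cintegrable_bounded (mA n) (Aoo n) (trig_poly_cmeasurable tp) pP).
Qed.

Lemma conj_dual_bounded chi : dual_group chi -> forall x, normc (conjc (chi x)) <= 1.
Proof. by move=> dchi x; rewrite normc_conj normc_dual. Qed.

Let mconj chi : dual_group chi -> cmeasurable (fun x => conjc (chi x)).
Proof. by move=> dchi; apply: cmeasurable_conj; exact: dual_cmeasurable. Qed.

Lemma mean_approximable_FB_cvg f chi : mean_approximable f -> dual_group chi ->
  cvgn (fun n => mean mu (A n) (fun s => f s * conjc (chi s))).
Proof.
move=> [mf intf fa] dchi; apply: cvgc_cauchy => e e0.
(* [mean_diffM_le] doubles the error, which leaves [e / 2] for the convergence of the means of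
   [p]. *)
have e40 : 0 < e / 4 by rewrite divr_gt0.
have [p tp fp] := fa _ e40; have [m [c [xi [dxi pE]]]] := tp.
exists (trig_coef c xi chi).
have e20 : 0 < e / 2 by rewrite divr_gt0.
have /cvgcP/(_ _ e20) pc := mean_trig_cvg G_hausdorff mu_haar A_vH dxi pE dchi.
apply: filterS2 fp pc => n fp pc.
have := mean_diffM_le mf (trig_poly_cmeasurable tp) (mconj dchi) (intf n)
  (trig_poly_cintegrable n tp) (conj_dual_bounded dchi).
move=> H; apply: (le_lt_trans (normc_dist_le
  (mean mu (A n) (fun s => p s * conjc (chi s))) _ _)).
by lra.
Qed.

Lemma FB_dist_le f p chi e (a b : R[i]) : cmeasurable f ->
  (forall n, cintegrable mu (A n) f) -> trig_poly p ->
  (\forall n \near \oo, rmean mu (A n) (fun x => normc (f x - p x)) < e) ->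
  dual_group chi ->
  mean mu (A n) (fun x => f x * conjc (chi x)) @[n --> \oo] --> a ->
  mean mu (A n) (fun x => p x * conjc (chi x)) @[n --> \oo] --> b ->
  normc (a - b) <= 2 * e.
Proof.
move=> mf intf tp fp dchi fa pb; apply: (normc_lim_le fa pb).
apply: filterS fp => n fp.
have := mean_diffM_le mf (trig_poly_cmeasurable tp) (mconj dchi) (intf n)
  (trig_poly_cintegrable n tp) (conj_dual_bounded dchi).
by lra.
Qed.

Lemma FB_norm_le f chi (M : R) (a : R[i]) : cmeasurable f ->
  (forall x, normc (f x) <= M) -> dual_group chi ->
  mean mu (A n) (fun x => f x * conjc (chi x)) @[n --> \oo] --> a ->
  normc a <= 2 * M.
Proof.
move=> mf fM dchi fa; rewrite -[a]subr0.
apply: (normc_lim_le fa (cvg_cst 0)); apply: filterE => n; rewrite subr0.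
have fcM x : normc (f x * conjc (chi x)) <= M.
  by rewrite Normc.normcM normc_conj (normc_dual _ dchi) mulr1.
have ifc := cintegrable_bounded (mA n) (Aoo n) (cmeasurableM mf (mconj dchi)) fcM.
apply: (le_trans (mean_norm_le (mA n) (A0 n) (Aoo n) ifc)); rewrite ler_wpM2l//.
rewrite -[leRHS](rmean_cst (mA n) (A0 n) (Aoo n)).
apply: (le_rmean (mA n) (A0 n) (Aoo n)) => //.
- exact: (cintegrable_normc (mA n)).
- by apply: (@integrable_bounded _ _ _ _ (mA n) (Aoo n) _ `|M|).
Qed.

(** Boundedness of [g] lets [rmean_shift_le] be applied to [normc (g - q)], which is at most
    [C + Q]. The second [e] pays for the translation; the threshold in [n] depends on [t], the bound
    does not. *)
Lemma mean_shift_approx g q (C : R) t e : cmeasurable g -> trig_poly q ->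
  (forall x, normc (g x) <= C) ->
  (\forall n \near \oo, rmean mu (A n) (fun x => normc (g x - q x)) < e) -> 0 < e ->
  \forall n \near \oo, rmean mu (A n) (fun x => normc (g (x - t) - q (x - t))) < 2 * e.
Proof.
move=> mg tq gC gq e0.
have [Q _ qQ] := trig_poly_bounded tq.
have mgq : cmeasurable (fun x => g x - q x).
  have := cmeasurableD mg (cmeasurableM (cmeasurable_cst (-1)) (trig_poly_cmeasurable tq)).
  by under eq_fun do rewrite mulN1r.
have := @rmean_shift_le _ _ G_hausdorff _ mu_haar _ A_vH
  (fun x => normc (g x - q x)) (C + Q) t e (cmeasurable_normc mgq) _ e0.
move=> /(_ _)[|N _ NP].
  by move=> x; rewrite normc_ge0 (le_trans (normcB_le _ _))// lerD.
apply: filterS2 gq (ex_intro2 _ _ N I NP) => n gq H.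
by apply: (le_lt_trans H); lra.
Qed.

Section TwoFunctions.
Variables (f g : G -> R[i]) (C : R).
Hypotheses (fa : mean_approximable f) (ga : mean_approximable g).
Hypothesis gC : forall x, normc (g x) <= C.

Lemma eberlein_cintegrable t n : cintegrable mu (A n) (eberlein_integrand f g t).
Proof.
have [mf intf _] := fa; have [mg _ _] := ga.
apply: (@cintegrableM_bounded _ _ _ _ (mA n) _ _ C) => //.
  by apply: cmeasurable_conj; exact: cmeasurable_shift.
by move=> x; rewrite normc_conj.
Qed.

(* [p] is chosen before [q], since the error made on [g] is multiplied by the
   sup norm of [p]. *)
Lemma eberlein_approx e : 0 < e -> exists p q, [/\ trig_poly p, trig_poly q,
  forall t, \forall n \near \oo, normc (mean mu (A n) (eberlein_integrand f g t) -
    mean mu (A n) (eberlein_integrand p q t)) <= e &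
  forall chi (af ag ap aq : R[i]), dual_group chi ->
    mean mu (A n) (fun x => f x * conjc (chi x)) @[n --> \oo] --> af ->
    mean mu (A n) (fun x => g x * conjc (chi x)) @[n --> \oo] --> ag ->
    mean mu (A n) (fun x => p x * conjc (chi x)) @[n --> \oo] --> ap ->
    mean mu (A n) (fun x => q x * conjc (chi x)) @[n --> \oo] --> aq ->
    normc (ap * conjc aq - af * conjc ag) <= 2 * e].
Proof.
move=> e0; have [mf intf fap] := fa; have [mg intg gap] := ga.
have C0 : 0 <= C := le_trans (normc_ge0 _) (gC 0).
have C10 : 0 < C + 1 by rewrite ltr_wpDl.
(* This error gets multiplied by [C], the bound of [g], and by the 2 of [mean_diffM_le], giving at
   most [e / 2]. *)
have e10 : 0 < e / 4 / (C + 1) by rewrite !divr_gt0.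
have [p tp fp] := fap _ e10.
have [P P0 pP] := trig_poly_bounded tp.
have P10 : 0 < P + 1 by rewrite ltr_wpDl.
(* An eighth, because [mean_shift_approx] doubles this error once more before it is multiplied by
   [P] and by 2. *)
have e20 : 0 < e / 8 / (P + 1) by rewrite !divr_gt0.
have [q tq gq] := gap _ e20.
have mp := trig_poly_cmeasurable tp; have mq := trig_poly_cmeasurable tq.
have [Q _ qQ] := trig_poly_bounded tq.
have e1E : C * (e / 4 / (C + 1)) <= e / 4.
  by rewrite mulrCA ger_pMr ?divr_gt0// ler_pdivrMr// mul1r lerDl.
have e2E : P * (e / 8 / (P + 1)) <= e / 8.
  by rewrite mulrCA ger_pMr ?divr_gt0// ler_pdivrMr// mul1r lerDl.
exists p, q; split => //.
- move=> t; have gqt := mean_shift_approx t mg tq gC gq e20.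
  apply: filterS2 fp gqt => n fp gqt.
  have mgt : cmeasurable (fun x => conjc (g (x - t))).
    by apply: cmeasurable_conj; exact: cmeasurable_shift.
  have mqt : cmeasurable (fun x => conjc (q (x - t))).
    by apply: cmeasurable_conj; exact: cmeasurable_shift.
  have gtC x : normc (conjc (g (x - t))) <= C by rewrite normc_conj.
  have qtQ x : normc (conjc (q (x - t))) <= Q by rewrite normc_conj.
  have ip := trig_poly_cintegrable n tp.
  have igt := cintegrable_bounded (mA n) (Aoo n) mgt gtC.
  have iqt := cintegrable_bounded (mA n) (Aoo n) mqt qtQ.
  have H1 := mean_diffM_le mf mp mgt (intf n) ip gtC.
  have H2 := mean_diffM_le mgt mqt mp igt iqt pP.
  (* The intermediate mean pairs [p] with the translate of [g]: on one side [f - p] meets the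
     bounded [g], on the other [g - q] meets the bounded [p]. *)
  apply: (le_trans (normc_dist_le
    (mean mu (A n) (fun x => p x * conjc (g (x - t)))) _ _)).
  have -> : e = e / 2 + e / 2 by field.
  apply: lerD.
    apply: (le_trans H1); apply: (@le_trans _ _ (2 * (e / 4))); last by lra.
    by rewrite ler_wpM2l// (le_trans _ e1E)// ler_wpM2l// ltW.
  move: H2; under [X in mean _ _ X - _]eq_fun do rewrite mulrC.
  under [X in _ - mean _ _ X]eq_fun do rewrite mulrC.
  move=> /le_trans; apply; apply: (@le_trans _ _ (2 * (2 * (e / 8)))); last by lra.
  rewrite ler_wpM2l//; apply: (@le_trans _ _ (P * (2 * (e / 8 / (P + 1))))).
    rewrite ler_wpM2l// ltW//; apply: le_lt_trans gqt.
    by under [X in rmean _ _ X <= _]eq_fun do rewrite -rmorphB normc_conj.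
  by rewrite mulrCA ler_wpM2l.
move=> chi af ag ap aq dchi faf gag pap qaq.
have H1 := FB_dist_le mf intf tp fp dchi faf pap.
have H2 := FB_dist_le mg intg tq gq dchi gag qaq.
have H3 := FB_norm_le mp pP dchi pap.
have H4 := FB_norm_le mg gC dchi gag.
apply: (le_trans (normc_dist_le (ap * conjc ag) _ _)).
rewrite -mulrBr -mulrBl -rmorphB !Normc.normcM !normc_conj.
rewrite [normc (aq - ag)]normc_distC [normc (ap - af)]normc_distC.
have -> : 2 * e = e / 2 + (e + e / 2) by field.
apply: lerD.
  apply: (le_trans (ler_pM (normc_ge0 _) (normc_ge0 _) H3 H2)).
  by rewrite mulrACA -mulrA; lra.
apply: (le_trans (ler_pM (normc_ge0 _) (normc_ge0 _) H1 H4)).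
by rewrite mulrACA [_ * C]mulrC; lra.
Qed.

Lemma eberlein_cvg t :
  mean mu (A n) (eberlein_integrand f g t) @[n --> \oo] --> eberlein mu A f g t.
Proof.
suff : cvgn (fun n => mean mu (A n) (eberlein_integrand f g t)) by [].
apply: cvgc_cauchy => e e0; have e20 : 0 < e / 2 by rewrite divr_gt0.
have [p [q [tp tq pq _]]] := eberlein_approx e20.
have [E [_ tE _]] := eberlein_trig G_hausdorff mu_haar A_vH tp tq.
exists (E t); have /cvgcP/(_ _ e20) pqE := tE t.
apply: filterS2 (pq t) pqE => n H1 H2.
apply: (le_lt_trans (normc_dist_le (mean mu (A n) (eberlein_integrand p q t)) _ _)).
by rewrite [e]splitr ler_ltD.
Qed.

Lemma eberlein_dist_le p q E e : (forall t, \forall n \near \oo,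
    normc (mean mu (A n) (eberlein_integrand f g t) -
    mean mu (A n) (eberlein_integrand p q t)) <= e) ->
  (forall t, mean mu (A n) (eberlein_integrand p q t) @[n --> \oo] --> E t) ->
  forall t, normc (eberlein mu A f g t - E t) <= e.
Proof.
by move=> pq pqE t; apply: (normc_lim_le (@eberlein_cvg t) (pqE t)); exact: pq.
Qed.

Lemma eberlein_trig_approximable : trig_approximable (eberlein mu A f g).
Proof.
move=> e e0; have [p [q [tp tq pq _]]] := eberlein_approx e0.
have [E [tE pqE _]] := eberlein_trig G_hausdorff mu_haar A_vH tp tq.
by exists E => //; exact: eberlein_dist_le pq pqE.
Qed.

Lemma eberlein_SAP : SAP (eberlein mu A f g).
Proof. exact: trig_approximable_SAP eberlein_trig_approximable. Qed.

Lemma eberlein_cmeasurable : cmeasurable (eberlein mu A f g).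
Proof.
have [_ uF _] := eberlein_SAP.
by apply: continuous_cmeasurable; exact: unif_continuous_continuous.
Qed.

Lemma eberlein_FB_cvg chi (af ag : R[i]) : dual_group chi ->
  mean mu (A n) (fun x => f x * conjc (chi x)) @[n --> \oo] --> af ->
  mean mu (A n) (fun x => g x * conjc (chi x)) @[n --> \oo] --> ag ->
  mean mu (A n) (fun x => eberlein mu A f g x * conjc (chi x)) @[n --> \oo] -->
  af * conjc ag.
Proof.
move=> dchi faf gag; apply/cvgcP => e e0.
(* Two fifths are spent on replacing the convolution by [E], one on the convergence of the means of
   [E], and two on the distance between the products of coefficients. *)
have e50 : 0 < e / 5 by rewrite divr_gt0.
have [p [q [tp tq pq pqa]]] := eberlein_approx e50.
have [E [tE pqE EE]] := eberlein_trig G_hausdorff mu_haar A_vH tp tq.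
have FE := eberlein_dist_le pq pqE.
have [m [c [xi [dxi pE]]]] := tp; have [l [d [psi [dpsi qE]]]] := tq.
have pc := mean_trig_cvg G_hausdorff mu_haar A_vH dxi pE dchi.
have qc := mean_trig_cvg G_hausdorff mu_haar A_vH dpsi qE dchi.
have /cvgcP/(_ _ e50) Ec := EE _ _ _ dchi pc qc.
have Hpq := pqa _ _ _ _ _ dchi faf gag pc qc.
have [[M FM] _ _] := eberlein_SAP.
move: Ec; apply: filterS => n Ec.
have iF := cintegrable_bounded (mA n) (Aoo n) eberlein_cmeasurable FM.
have mE := trig_poly_cmeasurable tE.
have iE := trig_poly_cintegrable n tE.
have H := mean_diffM_le eberlein_cmeasurable mE (mconj dchi) iF iE
  (conj_dual_bounded dchi).
have HE : rmean mu (A n) (fun x => normc (eberlein mu A f g x - E x)) <= e / 5.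
  rewrite -[leRHS](rmean_cst (mA n) (A0 n) (Aoo n)).
  apply: (le_rmean (mA n) (A0 n) (Aoo n)) => //.
  - apply: (cintegrable_normc (mA n)).
    have := cintegrableD (mA n) iF (cintegrableZ (mA n) (-1) mE iE).
    by under eq_fun do rewrite mulN1r.
  - by apply: (@integrable_bounded _ _ _ _ (mA n) (Aoo n) _ `|e / 5|).
apply: (le_lt_trans (normc_dist_le (mean mu (A n) (fun x => E x * conjc (chi x))) _ _)).
have := normc_dist_le (trig_coef c xi chi * conjc (trig_coef d psi chi))
  (mean mu (A n) (fun x => E x * conjc (chi x))) (af * conjc ag).
by lra.
Qed.

Lemma eberlein_FB_exists chi : dual_group chi -> FB_exists mu A chi (eberlein mu A f g).
Proof.
move=> dchi; split.
  split=> [|K cK]; first exact: eberlein_cmeasurable.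
  have [[M FM] _ _] := eberlein_SAP.
  apply: (cintegrable_bounded _ _ eberlein_cmeasurable FM).
    exact: borel_compact.
  exact: (haar_compact mu_haar).
apply/cvg_ex; eexists; apply: eberlein_FB_cvg => //.
  exact: mean_approximable_FB_cvg fa dchi.
exact: mean_approximable_FB_cvg ga dchi.
Qed.

Lemma eberlein_FB chi : dual_group chi ->
  FB mu A chi (eberlein mu A f g) = FB mu A chi f * conjc (FB mu A chi g).
Proof.
move=> dchi; apply: limnc_eq; apply: eberlein_FB_cvg => //.
  exact: mean_approximable_FB_cvg fa dchi.
exact: mean_approximable_FB_cvg ga dchi.
Qed.

End TwoFunctions.
End BoundedCase.

(** * Besicovitch almost periodic functions *)

Lemma limn_esup_lt_near (R : realType) (u : nat -> \bar R) (l : \bar R) :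
  (limn_esup u < l)%E -> \forall n \near \oo, (u n < l)%E.
Proof.
move=> /ereal_inf_lt[_ [B nB <-] Bl]; apply: filterS nB => n Bn.
by apply: le_lt_trans Bl; apply: ereal_sup_ubound; exists n.
Qed.

Lemma poweR_half_lt (R : realType) (x : \bar R) (e : R) : 0 < e ->
  (x `^ 2^-1 < e%:E)%E -> (x < (e ^+ 2)%:E)%E.
Proof.
move=> e0; apply: contraTT; rewrite -!leNgt => ex.
have -> : e%:E = ((e ^+ 2)%:E `^ 2^-1)%E.
  by rewrite poweR_EFin powR12_sqrt ?sqr_ge0// sqrtr_sqr gtr0_norm.
apply: gt0_ler_poweR => //.
- by rewrite in_itv/= leey lee_fin sqr_ge0.
- by rewrite in_itv/= leey (le_trans _ ex)// lee_fin sqr_ge0.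
Qed.

(** * Invariance of integrals and means under changes on a null set *)

Section AlmostEverywhere.
Context {R : realType} {G : topologicalZmodType}.
Variable mu : {measure set (borel G) -> \bar R}.
Variables D N : set (borel G).
Hypotheses (mD : measurable D) (mN : measurable N) (N0 : mu N = 0%E).

Lemma integral_eq_off_null (h k : borel G -> R) : measurable_fun setT h ->
  measurable_fun setT k -> (forall x, ~ N x -> h x = k x) ->
  (\int[mu]_(x in D) (h x)%:E = \int[mu]_(x in D) (k x)%:E)%E.
Proof.
move=> mh mk hk; apply: ae_eq_integral => //.
- by apply/measurable_EFinP; exact: measurable_funTS.
- by apply/measurable_EFinP; exact: measurable_funTS.
exists N; split => // x; apply: contra_notP => Nx _.
by rewrite hk.
Qed.

Lemma integrable_eq_off_null (h k : borel G -> R) : measurable_fun setT h ->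
  measurable_fun setT k -> (forall x, ~ N x -> h x = k x) ->
  mu.-integrable D (EFin \o h) -> mu.-integrable D (EFin \o k).
Proof.
move=> mh mk hk /integrableP[_ ih]; apply/integrableP; split.
  by apply/measurable_EFinP; exact: measurable_funTS.
suff -> : (\int[mu]_(x in D) `|(EFin \o k) x| =
    \int[mu]_(x in D) `|(EFin \o h) x|)%E by [].
apply: (@integral_eq_off_null (fun x => `|k x|) (fun x => `|h x|)).
- exact: measurableT_comp.
- exact: measurableT_comp.
- by move=> x Nx; rewrite hk.
Qed.

Lemma mean_eq_off_null (f g : G -> R[i]) : cmeasurable f -> cmeasurable g ->
  (forall x, ~ N x -> f x = g x) -> mean mu D f = mean mu D g.
Proof.
move=> [rf jf] [rg jg] fg; rewrite !meanE /rmean /Rintegral.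
by congr Complex; congr (_ * fine _); apply: integral_eq_off_null => // x Nx; rewrite fg.
Qed.

Lemma cintegrable_eq_off_null (f g : G -> R[i]) : cmeasurable f ->
  cmeasurable g -> (forall x, ~ N x -> f x = g x) ->
  cintegrable mu D f -> cintegrable mu D g.
Proof.
move=> [rf jf] [rg jg] fg [irf ijf]; split.
  by apply: integrable_eq_off_null irf => // x Nx; rewrite fg.
by apply: integrable_eq_off_null ijf => // x Nx; rewrite fg.
Qed.
End AlmostEverywhere.

Section BesicovitchMeans.
Context {R : realType} {G : topologicalZmodType}.
Hypothesis G_hausdorff : hausdorff_space G.
Variable mu : {measure set (borel G) -> \bar R}.
Hypothesis mu_haar : haar_measure mu.
Variable A : (set G)^nat.
Hypothesis A_vH : van_hove mu A.
Implicit Types (t : G) (e : R) (n : nat) (f g p q chi : G -> R[i]).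

Let mA n : measurable (A n : set (borel G)).
Proof. exact: (vH_measurable A_vH). Qed.
Let A0 n : (0 < mu (A n))%E.
Proof. exact: (vH_gt0 A_vH). Qed.
Let Aoo n : (mu (A n) < +oo)%E.
Proof. exact: (vH_lty G_hausdorff mu_haar A_vH). Qed.

(** On a set of finite measure the constant 1 is integrable, and [normc f] is dominated by
    [1 + normc f ^+ 2]. *)
Lemma L2_cintegrable f (D : set (borel G)) : measurable D -> (mu D < +oo)%E ->
  cmeasurable f -> (\int[mu]_(x in D) (normc (f x) ^+ 2)%:E < +oo)%E ->
  mu.-integrable D (fun x => (normc (f x) ^+ 2)%:E) /\ cintegrable mu D f.
Proof.
move=> mD Doo mf f2; have [rf jf] := mf.
have i2 : mu.-integrable D (fun x => (normc (f x) ^+ 2)%:E).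
  apply/integrableP; split.
    apply/measurable_EFinP; apply: measurable_funTS.
    by apply: measurable_funX; exact: cmeasurable_normc.
  under eq_integral do rewrite gee0_abs ?lee_fin ?sqr_ge0//.
  exact: f2.
split => //; apply: (@le_cintegrable _ _ mu D mD f (fun x => 1 + normc (f x) ^+ 2)).
- exact: measurable_funTS.
- exact: measurable_funTS.
- have i1 : mu.-integrable D (EFin \o (fun _ : borel G => 1 : R)).
    by apply: (@integrable_bounded _ _ _ _ mD Doo _ 1) => // _; rewrite normr1.
  exact: (integrableD mD i1 i2).
- by move=> x _; have := sqr_ge0 (normc (f x) - 2^-1); rewrite sqrrB; lra.
Qed.

Lemma L2loc_L1loc f : L2loc mu f -> L1loc mu f.
Proof.
move=> [mf f2]; split => // K cK; apply: (L2_cintegrable _ _ mf (f2 K cK)).2.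
  exact: borel_compact.
exact: haar_compact.
Qed.

Lemma L1loc_cintegrable f n : L1loc mu f -> cintegrable mu (A n) f.
Proof.
move=> [_ /(_ _ (@vH_compact _ _ _ _ A_vH n))[rf jf]].
have mcA : measurable (closure (A n) : set (borel G)).
  by apply: borel_closed; exact: closed_closure.
by split; [move: rf|move: jf]; apply: integrableS => //; exact: subset_closure.
Qed.

Lemma Bap2_mean_approximable f : Bap2 mu A f -> mean_approximable mu A f.
Proof.
move=> [[L2f _] fa]; have [mf _] := L2f.
split => // [n|e e0]; first exact/L1loc_cintegrable/L2loc_L1loc.
have [p tp] := fa _ e0; rewrite /besicovitch_norm => /(poweR_half_lt e0).
move=> /limn_esup_lt_near fp; exists p => //; apply: filterS fp => n.
have Afin := vH_fin G_hausdorff mu_haar A_vH n.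
have An := vH_fine_gt0 G_hausdorff mu_haar A_vH n.
have mfp : cmeasurable (fun x => f x - p x).
  have := cmeasurableD mf (cmeasurableM (cmeasurable_cst (-1)) (trig_poly_cmeasurable tp)).
  by under eq_fun do rewrite mulN1r.
set I := (\int[mu]_(x in _) _)%E; rewrite [X in (X^-1)%E]Afin inver gt_eqF// => fpI.
(* The bound on the quotient already forces the integral to be finite, since [mu (A n)] is finite;
   so the difference is square integrable for these [n]. *)
have Ioo : (I < +oo)%E.
  rewrite ltey; apply/eqP => Iy; move: fpI.
  by rewrite Iy gt0_muley// lte_fin invr_gt0.
have [i2 ifp] := L2_cintegrable (mA n) (Aoo n) mfp Ioo.
have i2h : mu.-integrable (A n) (EFin \o (fun x : borel G =>
    (2 * e)^-1 * normc (f x - p x) ^+ 2)) by exact: (integrableZl (mA n) (2 * e)^-1 i2).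
have ic : mu.-integrable (A n) (EFin \o (fun _ : borel G => e / 2)).
  by apply: (@integrable_bounded _ _ _ _ (mA n) (Aoo n) _ `|e / 2|).
have H1 : rmean mu (A n) (fun x => normc (f x - p x) ^+ 2) < e ^+ 2.
  have Ifin : I \is a fin_num by exact: (integrable_fin_num (mA n) i2).
  move: fpI; rewrite -(fineK Ifin) -EFinM lte_fin.
  exact.
apply: (@le_lt_trans _ _ (rmean mu (A n)
    (fun x => e / 2 + (2 * e)^-1 * normc (f x - p x) ^+ 2))).
  apply: (le_rmean (mA n) (A0 n) (Aoo n)).
  - exact: (cintegrable_normc (mA n) ifp).
  - exact: (integrableD (mA n) ic i2h).
  - move=> x _; set y := normc _.
    have -> : e / 2 + (2 * e)^-1 * y ^+ 2 = y + (y - e) ^+ 2 / (2 * e).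
      by field; rewrite gt_eqF.
    by rewrite lerDl divr_ge0 ?sqr_ge0// mulr_ge0// ltW.
rewrite (rmeanD (mA n) ic i2h) (rmean_cst (mA n) (A0 n) (Aoo n)) (rmeanZ (mA n))//.
rewrite [ltRHS](_ : e = e / 2 + (2 * e)^-1 * e ^+ 2); last first.
  by field; rewrite gt_eqF.
by rewrite ltrD2l ltr_pM2l ?invr_gt0 ?mulr_gt0//.
Qed.

(** [g'] is [g] cut off to 0 on the set [N] where its modulus exceeds an essential bound. *)
Lemma Linfty_truncation g : Linfty mu g ->
  exists (C : R) (g' : G -> R[i]) (N : set (borel G)),
  [/\ cmeasurable g', forall x, normc (g' x) <= C,
      measurable N, mu N = 0%E & forall x, ~ N x -> g x = g' x].
Proof.
move=> [mg]; rewrite ess_sup_inf.ess_supEae => /ereal_inf_lt[y [Z [mZ Z0 gZ]] yoo].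
have yfin (r : R) : (r%:E <= y)%E -> r <= fine y.
  by case: y yoo {gZ} => [s| |]//= _; rewrite lee_fin.
(* The maximum makes [C] a bound also for the value 0 that [g'] takes on [N]. *)
pose C := Num.max (fine y) 0.
pose N : set (borel G) := [set x | ~ normc (g x) <= C].
have mM : measurable ([set x | normc (g x) <= C] : set (borel G)).
  have := cmeasurable_normc mg measurableT (measurable_itv `]-oo, C]).
  by rewrite setTI; congr measurable; apply/seteqP; split=> x /=; rewrite in_itv.
have mN : measurable N by exact: measurableC.
pose g' := fun x : G => ((\1_[set x : borel G | normc (g x) <= C] x : R)%:C)%C * g x.
exists C, g', N; split=> //.
- apply: cmeasurableM => //; split => /=; last exact: measurable_cst.
  exact: measurable_indic.
- move=> x; rewrite /g' indicE; have [|] := boolP (x \in _).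
    by rewrite inE /= mul1r.
  by rewrite mul0r Normc.normc0 le_max lexx orbT.
- apply/eqP; rewrite eq_le measure_ge0 andbT -Z0; apply: le_measure; rewrite ?inE//.
  apply: subset_trans gZ => x; apply: contra_not => /= gy.
  by rewrite le_max yfin.
- by move=> x /contrapT gxC; rewrite /g' indicE mem_set//= mul1r.
Qed.

Lemma mean_approximable_eq_off_null g g' (C : R) (N : set (borel G)) :
  measurable N -> mu N = 0%E -> (forall x, ~ N x -> g x = g' x) ->
  cmeasurable g' -> (forall x, normc (g' x) <= C) ->
  mean_approximable mu A g -> mean_approximable mu A g'.
Proof.
move=> mN N0 gg' mg' g'C [mg intg ga]; split => // [n|e /ga[p tp gp]].
  exact: (cintegrable_bounded (mA n) (Aoo n) mg' g'C).
exists p => //; apply: filterS gp => n; congr (_ < e).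
have Np := cmeasurableM (cmeasurable_cst (-1)) (trig_poly_cmeasurable tp).
have mgp := cmeasurableD mg Np; have mg'p := cmeasurableD mg' Np.
rewrite /rmean /Rintegral; congr (_ * fine _).
apply: (integral_eq_off_null (mA n) mN N0) => [||x Nx].
- by have := cmeasurable_normc mgp; under eq_fun do rewrite mulN1r.
- by have := cmeasurable_normc mg'p; under eq_fun do rewrite mulN1r.
- by rewrite gg'.
Qed.

End BesicovitchMeans.

(** * Passage from bounded to essentially bounded functions *)

Theorem theorem3p28 (R : realType) (G : topologicalZmodType)
    (G_hausdorff : hausdorff_space G)
    (G_locally_compact : locally_compact [set: G])
    (G_second_countable : @second_countable G)
    (mu : {measure set (borel G) -> \bar R}) (mu_haar : haar_measure mu)
    (A : (set G)^nat) (A_van_hove : van_hove mu A)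
    (f g : G -> R[i]) (f_bap : Bap2 mu A f) (g_bap : Bap2 mu A g)
    (g_bounded : Linfty mu g) :
  [/\ eberlein_exists mu A f g,
      SAP (eberlein mu A f g) &
      forall chi : G -> R[i], dual_group chi ->
        [/\ FB_exists mu A chi (eberlein mu A f g),
            FB_exists mu A chi f,
            FB_exists mu A chi g &
            FB mu A chi (eberlein mu A f g) = FB mu A chi f * conjc (FB mu A chi g)]].
Proof.
have fa := Bap2_mean_approximable G_hausdorff mu_haar A_van_hove f_bap.
have ga := Bap2_mean_approximable G_hausdorff mu_haar A_van_hove g_bap.
have [C [g' [N [mg' g'C mN N0 gg']]]] := Linfty_truncation g_bounded.
have ga' := mean_approximable_eq_off_null G_hausdorff mu_haar A_van_hove
  mN N0 gg' mg' g'C ga.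
have [mf _ _] := fa; have [mg _ _] := ga.
have mA n : measurable (A n : set (borel G)) by exact: (vH_measurable A_van_hove).
(* The integrand at [t] evaluates [g] at [s - t], so it is altered only on the translate [N + t],
   which is null by invariance. *)
pose Nt t : set (borel G) := shift_set N (- t).
have mNt t : measurable (Nt t) by exact: measurable_shift_set.
have Nt0 t : mu (Nt t) = 0%E by rewrite -N0 -(haar_shift mu_haar t mN).
have fgt t : cmeasurable (eberlein_integrand f g t).
  by apply: cmeasurableM => //; apply: cmeasurable_conj; exact: cmeasurable_shift.
have fgt' t : cmeasurable (eberlein_integrand f g' t).
  by apply: cmeasurableM => //; apply: cmeasurable_conj; exact: cmeasurable_shift.
have fgE t x : ~ Nt t x -> eberlein_integrand f g t x = eberlein_integrand f g' t x.
  by move=> Nx; rewrite /eberlein_integrand gg'.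
have meanfg t n : mean mu (A n) (eberlein_integrand f g t) =
    mean mu (A n) (eberlein_integrand f g' t).
  exact: (mean_eq_off_null (mA n) (mNt t) (Nt0 t) (fgt t) (fgt' t) (@fgE t)).
(* The means agree for every [t], so the convolutions are equal everywhere and not merely almost
   everywhere, as is needed to transfer [SAP]. *)
have fgF : eberlein mu A f g = eberlein mu A f g'.
  by apply/funext => t; rewrite /eberlein; under eq_fun do rewrite meanfg.
have FBg chi : dual_group chi -> FB mu A chi g = FB mu A chi g'.
  move=> dchi; rewrite /FB; congr (limn _); apply/funext => n.
  have mchi : cmeasurable (fun s => conjc (chi s)).
    by apply: cmeasurable_conj; exact: dual_cmeasurable.
  apply: (mean_eq_off_null (mA n) mN N0) => [||x Nx]; first exact: cmeasurableM.
    exact: cmeasurableM.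
  by rewrite gg'.
split.
- move=> t; split=> [n|].
    apply: (cintegrable_eq_off_null (mA n) (mNt t) (Nt0 t) (fgt' t) (fgt t)).
      by move=> x Nx; rewrite fgE.
    exact: (eberlein_cintegrable A_van_hove fa ga' g'C).
  under eq_fun do rewrite meanfg.
  apply/cvg_ex; eexists.
  exact: (eberlein_cvg G_hausdorff mu_haar A_van_hove fa ga' g'C).
- by rewrite fgF; exact: (eberlein_SAP G_hausdorff mu_haar A_van_hove fa ga' g'C).
move=> chi dchi; split.
- rewrite fgF.
  exact: (eberlein_FB_exists G_hausdorff mu_haar A_van_hove fa ga' g'C).
- split; first by apply: (L2loc_L1loc G_hausdorff mu_haar); case: f_bap => -[].
  exact: (mean_approximable_FB_cvg G_hausdorff mu_haar A_van_hove fa dchi).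
- split; first by apply: (L2loc_L1loc G_hausdorff mu_haar); case: g_bap => -[].
  exact: (mean_approximable_FB_cvg G_hausdorff mu_haar A_van_hove ga dchi).
- rewrite fgF FBg//.
  exact: (eberlein_FB G_hausdorff mu_haar A_van_hove fa ga' g'C dchi).
Qed.
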